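(* Let $\alpha$ be a non-zero algebraic number and let $x\in(0,\infty]$. Then there exists a sequence $\bar\alpha=(\alpha_1,\alpha_2,\ldots)\in\tau^{-1}(\alpha)\cap\mathcal X(\mathrm{Rad}(K_\alpha))$ such that $M_x(\alpha)=M_x(\bar\alpha)$. That is, the infimum defining $M_x(\alpha)$ is attained by a sequence all of whose entries lie in $\mathrm{Rad}(K_\alpha)$.
   Context: $\overline{\mathbb Q}^\times$ is the multiplicative group of non-zero algebraic numbers. For $f(z)=a\prod_{n=1}^N(z-\alpha_n)\in\mathbb C[z]$ with $a\neq 0$, the (logarithmic) Mahler measure is $M(f)=\log|a|+\sum_{n=1}^N\log^+|\alpha_n|$, where $\log^+ t=\max\{\log t,0\}$ (and $\log^+0=0$). For $\alpha\in\overline{\mathbb Q}^\times$, $M(\alpha)$ denotes the Mahler measure of the minimal polynomial of $\alpha$ over $\mathbb Z$ (primitive, irreducible, with integer coefficients). For a subgroup $H\le\overline{\mathbb Q}^\times$, $\mathcal X(H)=\{(\alpha_1,\alpha_2,\ldots):\alpha_n\in H,\ \alpha_n=1\text{ for all but finitely many }n\}$. The map $\tau:\mathcal X(\overline{\mathbb Q}^\times)\to\overline{\mathbb Q}^\times$ is $\tau(\alpha_1,\alpha_2,\ldots)=\prod_{n=1}^\infty\alpha_n$. For $x\in(0,\infty]$ and $(\alpha_1,\alpha_2,\ldots)\in\mathcal X(\overline{\mathbb Q}^\times)$, put $M_x(\alpha_1,\alpha_2,\ldots)=\left(\sum_{n=1}^\infty M(\alpha_n)^x\right)^{1/x}$ if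 $x<\infty$, and $M_\infty(\alpha_1,\alpha_2,\ldots)=\max_{n\ge1}M(\alpha_n)$. For $\alpha\in\overline{\mathbb Q}^\times$, the $x$-metric Mahler measure is $M_x(\alpha)=\inf\{M_x(\bar\alpha):\bar\alpha\in\tau^{-1}(\alpha)\}$. $K_\alpha$ denotes the Galois closure of $\mathbb Q(\alpha)$ over $\mathbb Q$. For a number field $K$, $\mathrm{Rad}(K)=\{\gamma\in\overline{\mathbb Q}^\times:\gamma^r\in K\text{ for some }r\in\mathbb N\}$, where $\mathbb N$ is the set of positive integers. *)

(* Defs.v *)
From HB Require Import structures.
From mathcomp Require Import all_boot all_order all_algebra all_field.
From mathcomp Require Import complex.
From mathcomp Require Import all_classical all_reals all_analysis.

Set Implicit Arguments.
Unset Strict Implicit.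
Unset Printing Implicit Defensive.

Import Order.TTheory GRing.Theory Num.Theory.

Local Open Scope classical_set_scope.
Local Open Scope ring_scope.
Local Open Scope complex_scope.

(* [algC] is the field of algebraic numbers; [R[i]], for a [realType] R, is the
   field of complex numbers, with [Normc.normc : R[i] -> R] as modulus. *)

(* [ln] is 0 outside of the positive reals, so log^+ 0 = 0. *)
Definition logp (R : realType) (t : R) : R := Num.max (ln t) 0.

Lemma logp0 (R : realType) : logp 0 = 0 :> R.
Proof. by rewrite /logp ln0 // maxxx. Qed.

Definition complex_roots (R : realType) (f : {poly R[i]}) : seq R[i] :=
  sval (closed_field_poly_normal f).

Lemma complex_rootsE (R : realType) (f : {poly R[i]}) :
  f = lead_coef f *: \prod_(z <- complex_roots f) ('X - z%:P).
Proof. exact: svalP (closed_field_poly_normal f). Qed.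

Definition poly_mahler (R : realType) (f : {poly R[i]}) : R :=
  ln (Normc.normc (lead_coef f)) +
  \sum_(z <- complex_roots f) logp (Normc.normc z).

(* [zcontents p = 1] says that p is primitive, and fixes its sign by making the
   leading coefficient positive. *)
Definition is_min_polyZ (alpha : algC) (p : {poly int}) : Prop :=
  [/\ zcontents p = 1, irreducible_poly p & root (map_poly intr p) alpha].

Definition min_polyZ (alpha : algC) : {poly int} := xget 0 (is_min_polyZ alpha).

Lemma min_polyZP (alpha : algC) : is_min_polyZ alpha (min_polyZ alpha).
Proof.
apply: xgetPex.
have [p [Dp mon_p] dv_p] := minCpolyP alpha.
have [q [a nz_a Dq]] := rat_poly_scale p.
have nz_p : p != 0 by apply: monic_neq0.
have nz_q : q != 0.
  by apply: contraNneq nz_p => q0; rewrite Dq q0 rmorph0 scaler0.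
pose P := zprimitive q.
have eqPp : map_poly intr P %= p.
  have nz_c : (a%:~R^-1 * (zcontents q)%:~R : rat) != 0.
    by rewrite mulf_neq0 ?invr_eq0 ?intr_eq0 ?zcontents_eq0.
  rewrite [in X in _ %= X]Dq [in X in _ %= X](zpolyEprim q) map_polyZ scalerA.
  by rewrite eqp_sym eqp_scale.
have toC (r : {poly int}) :
    map_poly (intr : int -> algC) r = map_poly ratr (map_poly intr r).
  by rewrite -map_poly_comp; apply: eq_map_poly => z /=; rewrite ratr_int.
exists P; split.
- by rewrite zcontents_primitive nz_q.
- apply/irreducible_rat_int; split.
    rewrite (eqp_size eqPp) -(size_map_poly (ratr : {rmorphism rat -> algC})).
    by rewrite -Dp size_minCpoly.
  move=> r sz_r dv_r.
  have dv_rp : r %| p by rewrite -(eqp_dvdr _ eqPp).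
  suff: r %= p by move/eqp_trans; apply; rewrite eqp_sym.
  have [s Ds] := dvdpP _ _ dv_rp.
  have: root (map_poly ratr (s * r)) alpha by rewrite -Ds dv_p.
  rewrite rmorphM rootM => /orP[]; rewrite dv_p => dv; last by rewrite /eqp dv_rp.
  have nz_s : s != 0 by apply: contraNneq nz_p => s0; rewrite Ds s0 mul0r.
  have nz_r : r != 0 by apply: contraNneq nz_p => r0; rewrite Ds r0 mulr0.
  case/negP: sz_r; have := dvdp_leq nz_s dv; rewrite Ds size_mul //.
  move: nz_s nz_r; rewrite -!size_poly_gt0.
  case: (size s) (size r) => [//|m] [//|[//|k]] _ _.
  by rewrite addSn addnS /= addnS ltnNge leq_addr.
- by rewrite toC dv_p (eqp_dvdr _ eqPp).
Qed.

Lemma is_min_polyZ_uniq (alpha : algC) (p q : {poly int}) :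
  is_min_polyZ alpha p -> is_min_polyZ alpha q -> p = q.
Proof.
have eq_dvd (u v : {poly int}) : is_min_polyZ alpha u -> is_min_polyZ alpha v ->
    u %| v.
  have [p0 [_ mon_p0] dv_p0] := minCpolyP alpha.
  have toC (r : {poly int}) :
      map_poly (intr : int -> algC) r = map_poly ratr (map_poly intr r).
    by rewrite -map_poly_comp; apply: eq_map_poly => z /=; rewrite ratr_int.
  move=> [_ /irreducible_rat_int[_ irr_u] u0] [_ _ v0].
  rewrite -dvdp_rat_int; move: u0 v0; rewrite !toC !dv_p0 => p0u p0v.
  suff /eqp_dvdl <- : p0 %= map_poly intr u by [].
  apply: irr_u => //; apply/eqP => sz1.
  have /(_ 1) := dv_p0; rewrite rmorph1 rootC oner_eq0 dvdp1 sz1 eqxx.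
  by move/esym.
move=> min_p min_q.
have [[cp irr_p _] [cq _ _]] := (min_p, min_q).
have prim (u : {poly int}) : zcontents u = 1 -> zprimitive u = u.
  by move=> cu; rewrite [RHS]zpolyEprim cu scale1r.
have [r Dq] := dvdpP_int (eq_dvd _ _ min_p min_q).
have [s Dp] := dvdpP_int (eq_dvd _ _ min_q min_p).
rewrite !prim // in Dp Dq.
have : p * (r * s) = p * 1 by rewrite mulrA -Dq -Dp mulr1.
move/(mulfI (irredp_neq0 irr_p)) => rs1.
have /size_poly1P[c _ Dr] : size r == 1%N.
  have : r \is a GRing.unit by apply/unitrPr; exists s.
  by rewrite poly_unitE => /andP[].
have := cq; rewrite Dq Dr mulrC mul_polyC zcontentsZ cp mulr1 => ->.
by rewrite scale1r.
Qed.

Definition mahler (R : realType) (alpha : algC) : R :=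
  poly_mahler (map_poly intr (min_polyZ alpha)).

Definition Qbar_units : set algC := [set alpha | alpha != 0].

Definition X_ (H : set algC) : set (nat -> algC) :=
  [set a | (forall n, H (a n)) /\ finite_set [set n | a n != 1]].

(* Product over the indices with a_n <> 1, which are finitely many on [X_ H]. *)
Definition tau (a : nat -> algC) : algC := \big[*%R/1]_(n \in [set: nat]) a n.

Definition tau_fiber (alpha : algC) : set (nat -> algC) :=
  X_ Qbar_units `&` tau @^-1` [set alpha].

(* The sum is over the indices with M(a_n)^r <> 0, finitely many since M(1) = 0.
   The case x = +oo is a maximum by [seq_mahlerT_max] below. The value at
   x = -oo is irrelevant, as only x > 0 is considered. *)
Definition seq_mahler (R : realType) (x : \bar R) (a : nat -> algC) : R :=
  match x with
  | r%:E => (\sum_(n \in [set: nat]) mahler R (a n) `^ r) `^ r^-1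
  | +oo%E => sup [set mahler R (a n) | n in [set: nat]]
  | -oo%E => 0
  end.

Lemma seq_mahlerT_max (R : realType) (a : nat -> algC) : X_ Qbar_units a ->
  exists2 n, seq_mahler +oo%E a = mahler R (a n)
    & forall k, mahler R (a k) <= mahler R (a n).
Proof.
move=> [_ fin_a].
have fin_M : finite_set [set mahler R (a n) | n in [set: nat]].
  apply: (@sub_finite_set _ _
      ([set mahler R (a n) | n in [set n | a n != 1]] `|` [set mahler R 1])).
    move=> _ [n _ <-] /=; have [->|an1] := eqVneq (a n) 1; first by right.
    by left; exists n.
  by rewrite finite_setU; split; [exact: finite_image|exact: finite_set1].
have [s Ds] := (finite_seqP _).1 fin_M.
have s0 : mahler R (a 0%N) \in s.
  by have : [set` s] (mahler R (a 0%N)) by rewrite -Ds; exists 0%N.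
have [m ms ge_m] : exists2 m, m \in s & forall y, y \in s -> y <= m.
  clear -s0; case: s s0 => // y s _; elim: s y => [|z s IHs] y.
    by exists y => [|z]; rewrite ?inE // => /eqP->.
  have [m ms ge_m] := IHs z; have [le_ym|lt_my] := leP y m.
    exists m => [|t]; first by rewrite inE ms orbT.
    by rewrite inE => /predU1P[->|/ge_m].
  exists y => [|t]; first exact: mem_head.
  by rewrite inE => /predU1P[->//|/ge_m /le_trans->//]; apply: ltW.
have [n _ Dn] : [set mahler R (a n) | n in [set: nat]] m by rewrite Ds.
have ge_n k : mahler R (a k) <= mahler R (a n).
  rewrite Dn; apply: ge_m.
  by have : [set` s] (mahler R (a k)) by rewrite -Ds; exists k.
exists n => //=; apply/eqP; rewrite eq_le; apply/andP; split.
  apply: ge_sup; first by exists (mahler R (a n)), n.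
  by move=> _ [k _ <-].
apply: ub_le_sup; last by exists n.
by exists (mahler R (a n)) => _ [k _ <-].
Qed.

Definition metric_mahler (R : realType) (x : \bar R) (alpha : algC) : R :=
  inf [set seq_mahler x a | a in tau_fiber alpha].

Definition subfield (K : set algC) : Prop := divring_closed [in K].

(* Every extension of Q inside [algC] is algebraic and separable, so it is
   Galois as soon as it is normal. *)
Definition galoisQ (K : set algC) : Prop :=
  subfield K /\
  forall p : {poly rat}, irreducible_poly p ->
    (exists2 z, K z & root (map_poly ratr p) z) ->
    forall z, root (map_poly ratr p) z -> K z.

Definition Q_adjoin (alpha : algC) : set algC := smallest subfield [set alpha].

Definition galois_closure (alpha : algC) : set algC :=
  smallest galoisQ (Q_adjoin alpha).

Lemma galois_closureP (alpha : algC) : galoisQ (galois_closure alpha).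
Proof.
split.
  split.
  - by apply/mem_set => K [[[K1 _ _] _] _]; exact: set_mem.
  - move=> u v /set_mem Ku /set_mem Kv; apply/mem_set => K K_P.
    have [[[_ KB _] _] _] := K_P.
    by apply: set_mem; apply: KB; apply/mem_set; [apply: Ku|apply: Kv].
  - move=> u v /set_mem Ku /set_mem Kv; apply/mem_set => K K_P.
    have [[[_ _ KV] _] _] := K_P.
    by apply: set_mem; apply: KV; apply/mem_set; [apply: Ku|apply: Kv].
move=> p irr_p [z Kz pz] t pt K K_P; have [[_ normK] _] := K_P.
by apply: (normK p irr_p) pt; exists z => //; apply: Kz.
Qed.

Definition Rad (K : set algC) : set algC :=
  Qbar_units `&` [set gamma | exists2 r : nat, (0 < r)%N & K (gamma ^+ r)].

(* Main.v *)
From HB Require Import structures.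
Require Import Defs.
From mathcomp Require Import all_boot all_order all_fingroup all_algebra all_field.
From mathcomp Require Import complex zify ring lra.
From mathcomp Require Import all_classical all_reals all_analysis.

(** Let [K] be the field generated by the conjugates of [alpha]. Take [gamma]
    in a Galois extension [L] of the rationals that contains [K], and let
    [f = a * prod_x (X - x)] be the minimal polynomial of [gamma] over the
    integers. Grouping the roots of [f] into orbits [B] under [Gal(L / K)]
    gives [P = a * prod_B (X - N_B)], where [N_B] is the product of the
    elements of [B]. The coefficients of [P] are Galois invariant, and they are
    algebraic integers because [a] times any product of distinct roots of [f]
    is one; hence [P] has integer coefficients. Clearly [M(P) <= M(f)], and
    [deg P <= [K : Q]].
    If [D] is the size of the orbit of [gamma], [N] its product and [beta] a
    [D]-th root of [N], then [beta] is in [Rad(K)] and is a root of [P(X^D)], so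
    [M(beta) <= M(P(X^D)) = M(P) <= M(gamma)]. Applied to each factor of
    [alpha], this gives a product of such [beta]s which differs from [alpha] by
    a root of unity, as one sees by taking norms to [K].
    If [gamma] is itself in [Rad(K)] then the elements of each orbit have the
    same absolute value, so [M(f) = M(P)]. As [deg P] is bounded, Northcott's
    argument leaves finitely many values of [M] on [Rad(K)] below any bound,
    hence finitely many values of [M_x] on sequences in [Rad(K)]. *)

Set Implicit Arguments.
Unset Strict Implicit.
Unset Printing Implicit Defensive.

Import Order.TTheory GRing.Theory Num.Theory.
Local Open Scope ring_scope.

(** * Mahler measure of integer polynomials *)

Section MahlerMeasure.
Variable R : realType.
Implicit Types (f g : {poly R[i]}) (p q : {poly int}) (s t : R).
Local Notation nc := (@Normc.normc R).
Local Notation toC p := (map_poly (intr : int -> R[i]) p).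
Local Notation m p := (poly_mahler (toC p)).

Lemma logp_ge0 t : 0 <= logp t.
Proof. by rewrite /logp le_max lexx orbT. Qed.

Lemma logpM_le s t : 0 <= s -> 0 <= t -> logp (s * t) <= logp s + logp t.
Proof.
rewrite le_eqVlt => /predU1P[<-|s_gt0].
  by rewrite mul0r logp0 add0r logp_ge0.
rewrite le_eqVlt => /predU1P[<-|t_gt0].
  by rewrite mulr0 logp0 addr0 logp_ge0.
rewrite {1}/logp lnM ?posrE // ge_max addr_ge0 ?logp_ge0 // andbT.
by rewrite lerD // /logp le_max lexx.
Qed.

Lemma logpX t n : 0 <= t -> logp (t ^+ n) = logp t *+ n.
Proof.
rewrite le_eqVlt => /predU1P[<-|t_gt0].
  rewrite expr0n logp0 mul0rn; case: (n == 0)%N; rewrite ?logp0 //.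
  by rewrite /logp ln1 maxxx.
rewrite /logp lnXn //; have [le0|ge0] := leP (ln t) 0.
  by rewrite mul0rn max_r // mulrn_wle0.
by rewrite max_l // mulrn_wge0 // ltW.
Qed.

Lemma logp_le t (c : R) : 0 <= t -> logp t <= c -> t <= expR c.
Proof.
rewrite le_eqVlt => /predU1P[<- _|t_gt0]; first exact: expR_ge0.
rewrite /logp ge_max => /andP[le_c _].
by rewrite -[t](@lnK R) ?posrE // ler_expR.
Qed.

Lemma normc_ge0 (z : R[i]) : 0 <= nc z.
Proof. by case: z => a b; rewrite sqrtr_ge0. Qed.

Lemma normcX (z : R[i]) n : nc (z ^+ n) = nc z ^+ n.
Proof.
elim: n => [|n IHn]; first by rewrite !expr0 Normc.normc1.
by rewrite !exprS Normc.normcM IHn.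
Qed.

Lemma normc_prod I (r : seq I) (P : pred I) (F : I -> R[i]) :
  nc (\prod_(i <- r | P i) F i) = \prod_(i <- r | P i) nc (F i).
Proof.
by elim/big_rec2: _ => [|i x y _ <-]; rewrite ?Normc.normc1 // Normc.normcM.
Qed.

Lemma normc_gt0 (z : R[i]) : z != 0 -> 0 < nc z.
Proof.
move=> z0; rewrite lt_def normc_ge0 andbT; apply: contraNneq z0.
by move/Normc.eq0_normc->.
Qed.

(** [complex_roots] is an arbitrary enumeration of the roots. By unique factorization any other one
    is a permutation of it, so every explicit splitting computes the measure. *)
Lemma poly_mahlerE (c : R[i]) (rs : seq R[i]) : c != 0 ->
  poly_mahler (c *: \prod_(z <- rs) ('X - z%:P)) =
    ln (nc c) + \sum_(z <- rs) logp (nc z).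
Proof.
move=> c0; rewrite /poly_mahler.
have lc : lead_coef (c *: \prod_(z <- rs) ('X - z%:P)) = c.
  by rewrite lead_coefZ (monicP (monic_prod_XsubC _ _ _)) mulr1.
have := complex_rootsE (c *: \prod_(z <- rs) ('X - z%:P)); rewrite lc.
move/(scalerI c0)/prod_XsubC_eq => eq_rs.
by rewrite perm_sym in eq_rs; rewrite (perm_big rs eq_rs).
Qed.

Lemma poly_mahlerM f g : f != 0 -> g != 0 ->
  poly_mahler (f * g) = poly_mahler f + poly_mahler g.
Proof.
move=> f0 g0; rewrite (complex_rootsE f) (complex_rootsE g).
rewrite -scalerAl -scalerAr scalerA -big_cat.
rewrite !poly_mahlerE ?mulf_neq0 ?lead_coef_eq0 //.
rewrite big_cat Normc.normcM lnM ?posrE ?normc_gt0 ?lead_coef_eq0 //=.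
by rewrite addrACA.
Qed.

Lemma poly_mahler_prod (I : eqType) (r : seq I) (F : I -> {poly R[i]}) :
  (forall i, i \in r -> F i != 0) ->
  poly_mahler (\prod_(i <- r) F i) = \sum_(i <- r) poly_mahler (F i).
Proof.
elim: r => [_|i r IHr nzF].
  rewrite !big_nil; have := @poly_mahlerE 1 [::] (oner_neq0 _).
  by rewrite !big_nil scale1r Normc.normc1 ln1 addr0.
rewrite !big_cons poly_mahlerM ?nzF ?mem_head ?IHr //.
  by move=> j jr; rewrite nzF // inE jr orbT.
rewrite prodf_seq_neq0; apply/allP => j jr /=.
by rewrite nzF // inE jr orbT.
Qed.

(** The [n] roots all have modulus [t] with [t ^+ n = nc w], so their contributions add up to
    [logp t *+ n = logp (t ^+ n)]. *)
Lemma poly_mahler_XnsubC (w : R[i]) n : (0 < n)%N ->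
  poly_mahler ('X^n - w%:P) = logp (nc w).
Proof.
move=> n0; have [rs Drs] := closed_field_poly_normal ('X^n - w%:P).
have mon := monicXnsubC w n0.
have sz : size rs = n.
  have := size_XnsubC w n0; rewrite Drs (monicP mon) scale1r size_prod_XsubC.
  by case.
rewrite (monicP mon) in Drs; rewrite {1}Drs poly_mahlerE ?oner_neq0 //.
rewrite Normc.normc1 ln1 add0r.
have rt z : z \in rs -> nc w = nc z ^+ n.
  rewrite -root_prod_XsubC -[\prod_(_ <- _) _]scale1r -Drs /root.
  by rewrite !hornerE subr_eq0 -normcX => /eqP->.
case: rs sz rt {Drs} => [|z0 rs] sz rt; first by rewrite -sz in n0.
have Dz z : z \in z0 :: rs -> logp (nc z) = logp (nc z0).
  move=> zin; have := rt _ zin; rewrite (rt z0) ?mem_head //.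
  by move/eqP; rewrite eqrXn2 ?normc_ge0 // => /eqP->.
rewrite (rt z0) ?mem_head // logpX ?normc_ge0 // -sz.
rewrite (eq_big_seq (fun=> logp (nc z0))) //.
by rewrite big_const_seq count_predT -Monoid.iteropE.
Qed.
Lemma intC_inj : injective (intr : int -> R[i]).
Proof. exact: intr_inj. Qed.

Lemma toC_neq0 p : p != 0 -> toC p != 0.
Proof. by move=> p0; rewrite map_poly_eq0_id0 ?intr_eq0 ?lead_coef_eq0. Qed.

Lemma lead_coef_toC p : lead_coef (toC p) = (lead_coef p)%:~R.
Proof. by rewrite lead_coef_map_inj //; apply: intC_inj. Qed.

Lemma normc_nat n : nc n%:R = n%:R.
Proof. by rewrite -[n%:R]/(1 *+ n) normcMn Normc.normc1. Qed.

Lemma normc_int (n : int) : nc n%:~R = `|n|%N%:R.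
Proof. by case: n => n; rewrite ?NegzE ?rmorphN ?normcN /= normc_nat. Qed.

Lemma normc_int_ge1 (n : int) : n != 0 -> 1 <= nc n%:~R.
Proof. by rewrite normc_int ler1n absz_gt0. Qed.

(** A non-zero integer has modulus at least 1. This is the source of the positivity of [m], and so
    of its monotonicity under divisibility. *)
Lemma mahler_lead_ge0 p : p != 0 -> 0 <= ln (nc (lead_coef (toC p))).
Proof.
by move=> p0; rewrite ln_ge0 // lead_coef_toC normc_int_ge1 ?lead_coef_eq0.
Qed.

Lemma int_mahler_ge0 p : p != 0 -> 0 <= m p.
Proof.
move=> p0; rewrite addr_ge0 ?mahler_lead_ge0 //.
by apply: sumr_ge0 => i _; apply: logp_ge0.
Qed.

(** Each factor ['X - z%:P] turns into ['X^n - z%:P], which has the same measure [logp (nc z)]. *)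
Lemma int_mahler_comp_Xn p n : p != 0 -> (0 < n)%N -> m (p \Po 'X^n) = m p.
Proof.
move=> p0 n0; rewrite map_comp_poly map_polyXn.
have := complex_rootsE (toC p).
set c := lead_coef _; set rs := complex_roots _ => Dp.
have c0 : c != 0 by rewrite lead_coef_eq0 toC_neq0.
rewrite Dp comp_polyZ poly_mahlerE // rmorph_prod /= -mul_polyC.
have E : \prod_(z <- rs) (('X - z%:P) \Po 'X^n) =
    \prod_(z <- rs) ('X^n - z%:P) :> {poly R[i]}.
  by apply: eq_bigr => z _; rewrite comp_polyB comp_polyX comp_polyC.
rewrite E poly_mahlerM ?polyC_eq0 //; last first.
  by rewrite prodf_seq_neq0; apply/allP => z _ /=; rewrite monic_neq0 ?monicXnsubC.
rewrite poly_mahler_prod => [|z _]; last by rewrite monic_neq0 ?monicXnsubC.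
have := @poly_mahlerE c [::] c0; rewrite !big_nil -mul_polyC mulr1 => ->.
rewrite addr0; congr (_ + _); apply: eq_bigr => z _.
by rewrite poly_mahler_XnsubC.
Qed.

End MahlerMeasure.

(** * Minimal polynomials over the integers and coefficient bounds *)

Section MinPolyZ.
Variable R : realType.
Implicit Types (p q : {poly int}) (beta : algC).
Local Notation nc := (@Normc.normc R).
Local Notation toC p := (map_poly (intr : int -> R[i]) p).
Local Notation m p := (poly_mahler (toC p)).

Lemma map_poly_ratr_intr (F : numFieldType) p :
  map_poly (intr : int -> F) p = map_poly ratr (map_poly (intr : int -> rat) p).
Proof. by rewrite -map_poly_comp; apply: eq_map_poly => z /=; rewrite ratr_int. Qed.

Lemma min_polyZ_neq0 beta : min_polyZ beta != 0.
Proof. by have [_ irr _] := min_polyZP beta; apply: irredp_neq0. Qed.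

Lemma eqp_min_polyZ beta (p : {poly rat}) :
  (forall q : {poly rat}, root (map_poly ratr q) beta = (p %| q)) ->
  p %= map_poly intr (min_polyZ beta).
Proof.
move=> dv_p.
have [_ /irreducible_rat_int[_ irr_u] u0] := min_polyZP beta.
move: u0; rewrite map_poly_ratr_intr dv_p => p0u.
apply: irr_u => //; apply/eqP => sz1.
have /(_ 1) := dv_p; rewrite rmorph1 rootC oner_eq0 dvdp1 sz1 eqxx.
by move/esym.
Qed.

(** Gauss's lemma: the divisor is primitive, so divisibility over the rationals has an integral
    quotient. *)
Lemma min_polyZ_dvdp beta q : root (map_poly intr q) beta ->
  exists r, q = min_polyZ beta * r.
Proof.
have [p _ dv_p] := minCpolyP beta.
have [zc irr rt] := min_polyZP beta.
rewrite map_poly_ratr_intr dv_p (eqp_dvdl _ (eqp_min_polyZ dv_p)).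
rewrite dvdp_rat_int => /dvdpP_int[r ->]; exists r.
by rewrite {2}[min_polyZ beta]zpolyEprim zc scale1r.
Qed.

Lemma mahler_ge0 beta : 0 <= mahler R beta.
Proof. exact/int_mahler_ge0/min_polyZ_neq0. Qed.

(** The cofactor of the minimal polynomial in [q] has integer coefficients, hence non-negative
    measure. *)
Lemma mahler_le beta q : q != 0 -> root (map_poly intr q) beta ->
  mahler R beta <= m q.
Proof.
move=> q0 /min_polyZ_dvdp[r Dq]; move: q0; rewrite Dq mulf_eq0 negb_or.
case/andP=> f0 r0; rewrite rmorphM /= poly_mahlerM ?toC_neq0 //.
by rewrite lerDl int_mahler_ge0.
Qed.

Lemma mahler_unity_root beta n : (0 < n)%N -> beta ^+ n = 1 -> mahler R beta = 0.
Proof.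
move=> n0 bn; apply/eqP; rewrite eq_le mahler_ge0 andbT.
have mon := monicXnsubC (1 : int) n0.
apply: le_trans (mahler_le (monic_neq0 mon) _) _.
  by rewrite rmorphB /= map_polyXn map_polyC /= /root !hornerE bn subrr.
rewrite rmorphB /= map_polyXn map_polyC /= poly_mahler_XnsubC //.
by rewrite Normc.normc1 /logp ln1 maxxx.
Qed.

Lemma mahler1 : mahler R 1 = 0.
Proof. exact: (@mahler_unity_root 1 1). Qed.

(** Multiplication by ['X - z%:P] with [nc z <= c] enlarges a uniform bound on the coefficients by a
    factor of at most [1 + c]. *)
Lemma normc_coef_prod_XsubC (rs : seq R[i]) (c : R) j : 0 <= c ->
    {in rs, forall z, nc z <= c} ->
  nc (\prod_(z <- rs) ('X - z%:P))`_j <= (1 + c) ^+ size rs.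
Proof.
move=> c0; elim: rs j => [|z rs IHrs] j le_c.
  rewrite !big_nil coefC; case: ifP => _; rewrite ?Normc.normc1 //.
  by rewrite Normc.normc0 ler01.
have {}IHrs k : nc (\prod_(z <- rs) ('X - z%:P))`_k <= (1 + c) ^+ size rs.
  by apply: IHrs => y yrs; rewrite le_c // inE yrs orbT.
rewrite !big_cons mulrBl coefB mul_polyC coefZ coefXM exprS.
apply: le_trans (le_normcD _ _) _; rewrite normcN Normc.normcM mulrDl mul1r.
apply: lerD; last by rewrite ler_pM ?normc_ge0 ?le_c ?mem_head.
case: ifP => _; rewrite ?IHrs // Normc.normc0.
by rewrite exprn_ge0 // addr_ge0.
Qed.

(** The measure is a sum of non-negative terms, so [B] bounds each of them: the leading coefficient
    and every root have modulus at most [expR B]. *)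
Lemma normc_coef_le p (B : R) j : p != 0 -> m p <= B ->
  nc (toC p)`_j <= expR B * (1 + expR B) ^+ (size p).-1.
Proof.
move=> p0 le_mB; have lg := mahler_lead_ge0 R p0.
have lp0 : lead_coef (toC p) != 0 by rewrite lead_coef_eq0 toC_neq0.
have sl_ge0 : 0 <= \sum_(z <- complex_roots (toC p)) logp (nc z).
  by apply: sumr_ge0 => z _; apply: logp_ge0.
have Dp := complex_rootsE (toC p).
have Dsz : (size p).-1 = size (complex_roots (toC p)).
  have := congr1 (fun q : {poly _} => size q) Dp.
  rewrite size_scale // size_prod_XsubC.
  by rewrite size_map_inj_poly; [move->|apply: intC_inj|].
rewrite Dp coefZ Normc.normcM Dsz.
have zB z : z \in complex_roots (toC p) -> nc z <= expR B.
  move=> zin; rewrite logp_le ?normc_ge0 //; apply: le_trans le_mB.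
  rewrite /poly_mahler (big_rem z zin) /=.
  apply: le_trans (_ : logp (nc z) +
    \sum_(y <- rem z (complex_roots (toC p))) logp (nc y) <= _).
    by rewrite lerDl sumr_ge0 // => y _; apply: logp_ge0.
  by rewrite lerDr.
apply: ler_pM; rewrite ?normc_ge0 //.
  rewrite -[nc _](@lnK R) ?posrE ?normc_gt0 // ler_expR.
  by apply: le_trans le_mB; rewrite /poly_mahler lerDl.
by apply: normc_coef_prod_XsubC; rewrite ?expR_ge0.
Qed.

End MinPolyZ.

(** * Number fields and their embeddings *)

Lemma pchar_fieldExt_rat (L : fieldExtType rat) : [pchar L] =i pred0.
Proof. by move=> p; rewrite pchar_lalg pchar_num. Qed.

Lemma in_alg_ratr (L : fieldExtType rat) (C : numFieldType)
    (f : {rmorphism L -> C}) (p : {poly rat}) :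
  map_poly f (map_poly (in_alg L) p) = map_poly ratr p.
Proof.
rewrite -map_poly_comp; apply: eq_map_poly => z /=.
by rewrite alg_num_field fmorph_rat.
Qed.

Lemma map_poly_intr_in_alg (L : fieldExtType rat) (p : {poly int}) :
  map_poly (intr : int -> L) p = map_poly (in_alg L) (map_poly intr p).
Proof.
rewrite -map_poly_comp; apply: eq_map_poly => z.
exact/esym/(rmorph_int (in_alg L)).
Qed.

Lemma map_poly_intr_morph (F K : fieldType) (f : {rmorphism F -> K}) (p : {poly int}) :
  map_poly f (map_poly intr p) = map_poly intr p.
Proof. by rewrite -map_poly_comp; apply: eq_map_poly => z /=; rewrite rmorph_int. Qed.

(* A primitive element is sent to a root of its minimal polynomial. *)
Lemma num_field_embedding (L : fieldExtType rat) (C : numClosedFieldType) :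
  inhabited {rmorphism L -> C}.
Proof.
have sepL : separable 1 {:L}.
  apply/separableP => y _; exact/pcharf0_separable/pchar_fieldExt_rat.
pose z := separable_generator 1 {:L}.
have genz : <<1; z>>%VS = fullv.
  by rewrite -(eq_adjoin_separable_generator sepL (sub1v _)).
have [p0 Dp0] := polyOver1P (minPolyOver 1 z).
have p0_neq0 : p0 != 0.
  rewrite -(map_poly_eq0 (in_alg L)) -Dp0; exact/monic_neq0/monic_minPoly.
have [w rw] : {w : C | root (map_poly ratr p0) w}.
  apply/sigW/closed_rootP; rewrite size_map_poly.
  by rewrite -(size_map_poly (in_alg L)) -Dp0 size_minPoly.
pose ev (q : {poly rat}) := (map_poly (in_alg L) q).[z].
pose ev' (q : {poly rat}) : C := (map_poly ratr q).[w].
(* Every relation satisfied by [z] is a multiple of [p0], hence holds at [w] too. This makes the map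
   sending [ev q] to [ev' q] well defined. *)
have ev0 q : ev q = 0 -> ev' q = 0.
  move/rootP/(minPoly_dvdp (alg_polyOver 1%AS _)).
  rewrite Dp0 dvdp_map => /dvdpP[r ->].
  by rewrite /ev' rmorphM hornerM (rootP rw) mulr0.
have evB q r : ev (q - r) = ev q - ev r by rewrite /ev rmorphB hornerD hornerN.
have ev'B q r : ev' (q - r) = ev' q - ev' r by rewrite /ev' rmorphB hornerD hornerN.
have evM q r : ev (q * r) = ev q * ev r by rewrite /ev rmorphM hornerM.
have ev'M q r : ev' (q * r) = ev' q * ev' r by rewrite /ev' rmorphM hornerM.
have ev_eq q r : ev q = ev r -> ev' q = ev' r.
  by move=> E; apply/eqP; rewrite -subr_eq0 -ev'B ev0 // evB E subrr.
have qof y : {q | ev q = y}.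
  apply: cid; have /Fadjoin_polyP[p /polyOver1P[q ->] ->] : y \in <<1; z>>%VS.
    by rewrite genz memvf.
  by exists q.
pose f y := ev' (sval (qof y)).
have fE q : f (ev q) = ev' q by apply: ev_eq; case: (qof _).
have fB : zmod_morphism f.
  move=> x y; rewrite -[x](svalP (qof x)) -[y](svalP (qof y)).
  by rewrite -evB !fE ev'B.
have fM : monoid_morphism f.
  split=> [|x y].
    have {1}<- : ev 1 = 1 by rewrite /ev rmorph1 hornerC.
    by rewrite fE /ev' rmorph1 hornerC.
  rewrite -[x](svalP (qof x)) -[y](svalP (qof y)).
  by rewrite -evM !fE ev'M.
pose faM := GRing.isZmodMorphism.Build _ _ f fB.
pose fmM := GRing.isMonoidMorphism.Build _ _ f fM.
by pose F : {rmorphism _ -> _} := HB.pack f faM fmM; split; exact: F.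
Qed.

(** The field is generated by all the roots of a product of minimal polynomials of the members of
    [s], so it is a splitting field and contains [s]. *)
Lemma splitting_num_field_exists (s : seq algC) :
  exists (L : splittingFieldType rat) (QC : {rmorphism L -> algC}) (s1 : seq L),
    map QC s1 = s.
Proof.
have p_ (x : algC) : {p : {poly rat} | p != 0 & root (map_poly ratr p) x}.
  have [p [_ mon_p] dv_p] := minCpolyP x.
  by exists p; [exact: monic_neq0 | rewrite dv_p].
pose pr x := s2val (p_ x); pose p := \prod_(x <- s) pr x.
have p_neq0 : p != 0.
  by rewrite prodf_seq_neq0; apply/allP => x _; apply: (s2valP (p_ x)).
have [rs Drs] := closed_field_poly_normal (map_poly ratr p : {poly algC}).
have lc : lead_coef (map_poly ratr p : {poly algC}) != 0.
  by rewrite lead_coef_eq0 map_poly_eq0.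
have [L0 [QC [r1 Dr1 genL]]] := num_field_exists rs.
have L0_ax : FieldExt_isSplittingField _ L0.
  constructor; exists (map_poly (in_alg L0) p); first exact: alg_polyOver.
  exists r1 => //; rewrite -(eqp_map QC) in_alg_ratr Drs.
  by rewrite map_prod_XsubC -(big_map QC predT (fun z => 'X - z%:P)) Dr1 eqp_scale.
pose L : splittingFieldType rat := HB.pack L0 L0_ax.
have inrs x : x \in s -> x \in rs.
  move=> xs; rewrite -root_prod_XsubC -(rootZ _ _ lc) -Drs /p.
  rewrite rmorph_prod rootE horner_prod prodf_seq_eq0; apply/hasP; exists x => //=.
  exact: (s2valP' (p_ x)).
exists L, QC, [seq r1`_(index x rs) | x <- s].
rewrite -map_comp -[RHS]map_id; apply/eq_in_map => x /inrs xrs /=.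
by rewrite -(nth_map _ 0) ?Dr1 ?nth_index // -(size_map QC) Dr1 index_mem.
Qed.

(** * Integrality of products of roots *)

Section Integrality.
Variables (A : comNzRingType) (K : fieldType) (iota : {rmorphism A -> K}).
Local Notation integral := (integralOver iota).
Implicit Types (p q : {poly K}) (x c : K).

Lemma integral_exp x n : integral x -> integral (x ^+ n).
Proof.
move=> xint; elim: n => [|n IHn]; first by rewrite expr0; apply: mxpoly.integral1.
by rewrite exprS; apply: integral_mul.
Qed.

Lemma integral_lead_coef_root p x :
  (forall i, integral p`_i) -> root p x -> integral (lead_coef p * x).
Proof.
move=> pint px0.
have [->|p0] := eqVneq p 0; first by rewrite lead_coef0 mul0r; apply: mxpoly.integral0.
have sz_p := root_size_gt1 p0 px0.
have [n Dn] : {n | size p = n.+2}.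
  by exists (size p).-2; case: (size p) sz_p => [|[|n]].
set a := lead_coef p; have Da : a = p`_n.+1 by rewrite /a lead_coefE Dn.
have aint : integral a by rewrite Da.
(* [q] is [a ^+ n * p (X / a)], which is monic. *)
pose q := \poly_(i < n.+2) (if (i < n.+1)%N then p`_i * a ^+ (n - i) else 1).
have q_coef i : q`_i = if (i < n.+1)%N then p`_i * a ^+ (n - i) else (i == n.+1)%:R.
  rewrite coef_poly; case: ltnP => [lt_i|le_i].
    by case: ltnP => // le_ni; rewrite eqn_leq le_ni -ltnS lt_i.
  by rewrite ltnNge (ltnW le_i) /= gtn_eqF.
have sz_q : size q = n.+2 by rewrite size_poly_eq // ltnn oner_eq0.
apply: (@integral_root_monic _ _ _ _ q).
- by rewrite monicE lead_coefE sz_q /= q_coef ltnn eqxx.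
- rewrite rootE horner_coef sz_q big_ord_recr /= q_coef ltnn eqxx mul1r.
  rewrite (eq_bigr (fun i : 'I_n.+1 => p`_i * x ^+ i * a ^+ n)) => [|i _]; last first.
    have -> : a ^+ n = a ^+ i * a ^+ (n - i) by rewrite -exprD subnKC // -ltnS.
    by rewrite q_coef ltn_ord exprMn; move: (a ^+ (n - i)) => b; ring.
  rewrite -mulr_suml exprMn exprS -mulrA [a ^+ n * _]mulrC mulrA -mulrDl.
  have := rootP px0; rewrite horner_coef Dn big_ord_recr /= -Da => ->.
  by rewrite mul0r.
apply/integral_poly => i; rewrite q_coef; case: ifP => _.
  by apply: integral_mul => //; apply: integral_exp.
exact: mxpoly.integral_nat.
Qed.

(** A root can be divided out even if it is not integral itself. The induction is on the size of
    [q], whose leading term is removed at each step. *)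
Lemma integral_coef_divXsubC q x :
  (forall i, integral (q * ('X - x%:P))`_i) -> forall i, integral q`_i.
Proof.
elim: {q}_.+1 {-2}q (ltnSn (size q)) => // n IHn q sz_q pint.
have [->|q0] := eqVneq q 0; first by move=> i; rewrite coef0; apply: mxpoly.integral0.
(* Both [c] and [c * x] are integral, so the leading term of [q] can be removed. *)
pose c := lead_coef q; pose k := (size q).-1.
have lc : lead_coef (q * ('X - x%:P)) = c by rewrite lead_coefM lead_coefXsubC mulr1.
have cint : integral c by rewrite -lc lead_coefE.
have cxint : integral (c * x).
  rewrite -lc; apply: integral_lead_coef_root => //.
  by rewrite rootM root_XsubC eqxx orbT.
pose q' := q - c *: 'X^k.
have q'int : forall i, integral q'`_i.
  apply: IHn.
    have Dk : size q = k.+1 by rewrite /k prednK // size_poly_gt0.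
    rewrite -ltnS; apply: leq_ltn_trans sz_q; rewrite Dk ltnS.
    apply/leq_sizeP => i; rewrite leq_eqVlt coefB coefZ coefXn => /predU1P[<-|lt_ki].
      by rewrite eqxx mulr1 subrr.
    by rewrite gtn_eqF // mulr0 subr0 nth_default // Dk.
  move=> i; rewrite mulrBl coefB; apply: integral_sub => //.
  rewrite -scalerAl mulrBr coefZ coefB coefMC -exprSr !coefXn mulrBr.
  apply: integral_sub; first by apply: integral_mul => //; apply: mxpoly.integral_nat.
  by rewrite mulrCA mulrC; apply: integral_mul => //; apply: mxpoly.integral_nat.
move=> i; have -> : q = q' + c *: 'X^k by rewrite subrK.
rewrite coefD coefZ coefXn; apply: integral_add => //.
by apply: integral_mul => //; apply: mxpoly.integral_nat.
Qed.

Lemma integral_coef_sub_prod c (t u : seq K) :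
  (forall i, integral (c *: \prod_(x <- t ++ u) ('X - x%:P))`_i) ->
  forall i, integral (c *: \prod_(x <- t) ('X - x%:P))`_i.
Proof.
elim/last_ind: u => [|u x IHu]; first by rewrite cats0.
rewrite -rcons_cat -cats1 big_cat big_seq1 scalerAl /= => pint.
exact/IHu/(integral_coef_divXsubC pint).
Qed.

(** Dividing out the roots outside [t] keeps the coefficients integral, and the constant one is then
    [c * \prod_(x <- t) x] up to sign. *)
Lemma integral_sub_prod c (t rs : seq K) :
  (exists u, perm_eq (t ++ u) rs) ->
  (forall i, integral (c *: \prod_(x <- rs) ('X - x%:P))`_i) ->
  integral (c * \prod_(x <- t) x).
Proof.
case=> u eq_rs; rewrite -(perm_big _ eq_rs) => /integral_coef_sub_prod /(_ 0%N).
rewrite coefZ coef0_prod_XsubC mulrCA => rint.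
rewrite -[c * _](signrMK (size t)).
apply: integral_mul => //; apply: integral_exp.
exact/integral_opp/mxpoly.integral1.
Qed.

(** Up to sign, the coefficients are sums of products of [c] with sublists of the [N B], and masks
    enumerate these. In the induction the head is either skipped or absorbed into [c]. *)
Lemma integral_coef_prod_XsubC c (I : Type) (bs : seq I) (N : I -> K) :
  (forall m : bitseq, integral (c * \prod_(B <- mask m bs) N B)) ->
  forall j, integral (c *: \prod_(B <- bs) ('X - (N B)%:P))`_j.
Proof.
elim: bs c => [|B bs IHbs] c cint j.
  rewrite big_nil alg_polyC coefC; case: ifP => _; last exact: mxpoly.integral0.
  by have := cint [::]; rewrite big_nil mulr1.
rewrite big_cons mulrBl scalerBr coefB; apply: integral_sub.
  rewrite scalerAr coefXM; case: ifP => _; first exact: mxpoly.integral0.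
  by apply: IHbs => m; apply: (cint (false :: m)).
rewrite mul_polyC scalerA; apply: IHbs => m.
by have := cint (true :: m); rewrite /= big_cons mulrA.
Qed.
End Integrality.

(** * The orbit polynomial *)

Section NormalOrbits.
Variables (aT : finGroupType) (T : finType) (to : {action aT &-> T}).
Variables (G H : {group aT}).
Hypothesis nHG : fingroup.normal H G.

Lemma setact_orbit_normal x g : g \in G ->
  setact to (orbit to H x) g = orbit to H (to x g).
Proof.
move=> Gg; have nHg : (H :^ g)%g = H.
  by apply: normP; apply: (fintype.subsetP (normal_norm nHG)).
apply/finset.setP => y; rewrite -{2}nHg -[y](actKV to g) orbit_conjsg.
by apply/imsetP/idP => [[u ux /act_inj->]|yx]; last exists (to y g^-1%g).
Qed.

Lemma big_orbits_act (S : Type) (idx : S) (op : Monoid.com_law idx) g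
    (F : {set T} -> S) : g \in G ->
  \big[op/idx]_(B in orbit to H @: [set: T]) F B =
    \big[op/idx]_(B in orbit to H @: [set: T]) F (setact to B g).
Proof.
move=> Gg; apply: (@reindex_acts _ _ _ (to^*)%act _ _ _ _ G) => //.
apply/actsP => k Gk B; apply/imsetP/imsetP => [[x _ Dx]|[x _ ->]]; last first.
  by exists (to x k) => //; apply: setact_orbit_normal.
exists (to x k^-1%g) => //; apply: (act_inj (to^*)%act k) => /=.
by rewrite setact_orbit_normal // actKV.
Qed.

Lemma big_orbits (S : Type) (idx : S) (op : Monoid.com_law idx) (F : T -> S) :
  \big[op/idx]_x F x =
    \big[op/idx]_(B in orbit to H @: [set: T]) \big[op/idx]_(x in B) F x.
Proof.
rewrite -(set_partition_big _ (orbit_partition _)); last first.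
  by apply/actsP => h Hh x; rewrite !inE.
by apply: eq_bigl => x; rewrite inE.
Qed.

(** The elements of [H] sending [x] to a given [y] form a coset of the stabilizer, so each point of
    the orbit is hit equally often. *)
Lemma prod_act_orbit (K : comRingType) (F : T -> K) x :
  \prod_(h in H) F (to x h) =
    (\prod_(y in orbit to H x) F y) ^+ #|('C_H[x | to])%g|.
Proof.
rewrite (partition_big (to x) [in orbit to H x]) => [|h Hh]; last exact: mem_orbit.
rewrite -prodrXl; apply: eq_bigr => y /orbitP[h Hh Dy].
rewrite (eq_bigr (fun=> F y)) => [|k /andP[_ /eqP->]] //.
rewrite prodr_const; congr (_ ^+ _).
rewrite -(card_rcoset _ h) -(amove_act to x (finset.subsetT H) Hh) Dy.
by apply: eq_card => k; rewrite !inE.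
Qed.

(** By normality the [H]-orbit of [to x g] depends only on the coset of [g], and by transitivity
    every orbit arises in this way. *)
Lemma card_orbits_le x : (forall y, exists2 g, g \in G & to x g = y) ->
  (#|orbit to H @: [set: T]| <= #|G : H|%g)%N.
Proof.
move=> transG; pose F (C : {set aT}) := orbit to H (to x (repr C)).
apply: leq_trans (leq_imset_card F _); apply/subset_leq_card/fintype.subsetP.
move=> _ /imsetP[y _ ->]; have [g Gg <-] := transG y.
apply/imsetP; exists (H :* g)%g; first by apply/imsetP; exists g; rewrite ?rcosetE.
rewrite /F; case: repr_rcosetP => h Hh.
rewrite -!(setact_orbit_normal _ Gg) // actM -setact_orbit_normal //.
by rewrite orbit_act.
Qed.
End NormalOrbits.

Lemma logp_prod_le (R : realType) (I : Type) (r : seq I) (P : pred I) (F : I -> R) :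
    (forall i, 0 <= F i) ->
  logp (\prod_(i <- r | P i) F i) <= \sum_(i <- r | P i) logp (F i).
Proof.
move=> F0; pose K (x y : R) := 0 <= x /\ logp x <= y.
(* The invariant [K] carries the non-negativity of the partial product, which [logpM_le]
   requires. *)
suff [] : K (\prod_(i <- r | P i) F i) (\sum_(i <- r | P i) logp (F i)) by [].
elim/big_rec2: _ => [|i y x _ [x0 le_xy]]; split=> //.
- by rewrite /logp ln1 maxxx.
- exact: mulr_ge0.
by apply: le_trans (logpM_le (F0 i) x0) _; rewrite lerD2l.
Qed.

(** * Galois action on the roots of a minimal polynomial *)

Section OrbitPolynomial.
Variables (L : splittingFieldType rat) (QC : {rmorphism L -> algC}).
Implicit Types (p : {poly int}) (c x y : L).

Lemma intL_inj : injective (intr : int -> L).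
Proof. by move=> m n /(congr1 QC); rewrite !rmorph_int => /intr_inj. Qed.

Lemma galois_fullv : galois 1 {:L}.
Proof.
rewrite /galois sub1v normalFieldf andbT; apply/separableP => y _.
exact/pcharf0_separable/pchar_fieldExt_rat.
Qed.

(** A rational algebraic integer is an integer; [QC] transports this fact from [algC]. *)
Lemma integral_fixed_int y : y \in 1%VS -> integralOver (intr : int -> L) y ->
  exists n : int, y = n%:~R.
Proof.
case/vlineP => r ->; set z := _ *: _ => /(integral_rmorph QC).
case=> p mon_p rt.
have Az : QC z \in Aint.
  apply: root_monic_Aint (_ : root (map_poly intr p) _) _ _.
  - by move: rt; congr (root _ _); apply: eq_map_poly => a /=; rewrite rmorph_int.
  - exact: monic_map.
  by apply/polyOverP => i; rewrite coef_map /= intr_int.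
have Cz : QC z \in Crat by rewrite /z alg_num_field fmorph_rat Crat_rat.
have /intrP[n Dn] := Cint_rat_Aint Cz Az.
by exists n; apply: (fmorph_inj QC); rewrite Dn rmorph_int.
Qed.

Lemma map_poly_intr_minPoly (gamma : L) (f := min_polyZ (QC gamma)) :
  map_poly intr f = (lead_coef f)%:~R *: minPoly 1 gamma.
Proof.
have [p0 Dp0] := polyOver1P (minPolyOver 1 gamma).
have [_ /irreducible_rat_int[_ irr_f] rt] := min_polyZP (QC gamma).
have dvp : p0 %| map_poly intr f.
  rewrite -(dvdp_map (in_alg L)) -Dp0 -map_poly_intr_in_alg.
  rewrite minPoly_dvdp //; first by rewrite map_poly_intr_in_alg alg_polyOver.
  by rewrite -(fmorph_root QC) map_poly_intr_morph.
have : minPoly 1 gamma %= map_poly intr f.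
  rewrite map_poly_intr_in_alg Dp0 eqp_map; apply: irr_f => //.
  rewrite -(size_map_poly (in_alg L)) -Dp0 size_minPoly.
  by rewrite eqSS.
move/eqp_eq; rewrite (monicP (monic_minPoly _ _)) scale1r => <-.
by rewrite lead_coef_map_inj //; apply: intL_inj.
Qed.

Variables (E : {subfield L}).
Hypothesis nE : normalField 1 E.
Local Notation G := ('Gal({:L} / 1))%g.
Local Notation H := ('Gal({:L} / E))%g.

Lemma gal_normal : fingroup.normal H G.
Proof. by apply: normalField_normal; rewrite ?sub1v ?subvf. Qed.

(** This links the definition by complex roots with splittings in [L], where the Galois group acts:
    any embedding [kappa] carries one to the other. *)
Lemma poly_mahler_split (R : realType) (kappa : {rmorphism L -> R[i]}) p c
    (I : finType) (A : {pred I}) (F : I -> L) : p != 0 ->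
    map_poly intr p = c *: \prod_(i in A) ('X - (F i)%:P) ->
  poly_mahler (map_poly (intr : int -> R[i]) p) =
    ln (Normc.normc (kappa c)) +
    \sum_(i in A) logp (Normc.normc (kappa (F i))).
Proof.
move=> p0 Dp.
have c0 : c != 0.
  apply: contra_neq p0 => c0; apply: (map_inj_poly intL_inj) => //.
  by rewrite Dp c0 scale0r rmorph0.
rewrite -(map_poly_intr_morph kappa) Dp map_polyZ map_prod_XsubC.
rewrite -big_enum -(big_map (fun i => kappa (F i)) predT (fun z => 'X - z%:P)).
by rewrite poly_mahlerE ?fmorph_eq0 // big_map big_enum.
Qed.

Section Orbits.
Variable gamma : L.

Lemma gal_roots : exists2 rs, uniq rs &
  minPoly 1 gamma = \prod_(x <- rs) ('X - x%:P).
Proof.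
have /normalFieldP/(_ gamma (memvf _))[rs _ Drs] := normalFieldf (1%AS : {subfield L}).
exists rs => //; rewrite -separable_prod_XsubC -Drs.
exact/pcharf0_separable/pchar_fieldExt_rat.
Qed.

Variables (rs : seq L).
Hypotheses (uniq_rs : uniq rs)
  (Drs : minPoly 1 gamma = \prod_(x <- rs) ('X - x%:P)).

Lemma mem_gal_roots x : (x \in rs) = root (minPoly 1 gamma) x.
Proof. by rewrite Drs root_prod_XsubC. Qed.

Lemma gal_all (g : gal_of {:L}) : g \in G.
Proof. by rewrite gal_kHom ?sub1v // k1HomE; exact: (valP (gal_repr g)). Qed.

Lemma gal_roots_stable (g : gal_of {:L}) x : x \in rs -> g x \in rs.
Proof.
rewrite !mem_gal_roots => rt.
by rewrite -(fixedPoly_gal (sub1v _) (gal_all g) (minPolyOver _ _)) fmorph_root.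
Qed.

(** The roots are packed as [seq_sub rs] because orbits are taken in a finite type. *)
Definition gal_roots_act (x : seq_sub rs) (g : gal_of {:L}) : seq_sub rs :=
  SeqSub (gal_roots_stable g (valP x)).

Lemma gal_roots_act1 : gal_roots_act^~ 1%g =1 id.
Proof. by move=> x; apply: val_inj; rewrite /= gal_id. Qed.

Lemma gal_roots_actM (x : seq_sub rs) : act_morph gal_roots_act x.
Proof. by move=> g h; apply: val_inj; rewrite /= galM ?memvf. Qed.

Canonical gal_roots_action := TotalAction gal_roots_act1 gal_roots_actM.
Local Notation to := gal_roots_action.
Local Notation orbH := (orbit to H).
Local Notation Bs := (orbH @: [set: seq_sub rs]).

Definition orbit_norm (B : {set seq_sub rs}) : L := \prod_(x in B) val x.

Lemma gal_orbit_norm (g : gal_of {:L}) B :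
  g (orbit_norm B) = orbit_norm (setact to B g).
Proof.
rewrite /orbit_norm rmorph_prod /= big_imset //=.
by move=> x y _ _; apply: act_inj.
Qed.

Lemma gamma_in_roots : gamma \in rs.
Proof. by rewrite mem_gal_roots root_minPoly. Qed.
Local Notation x0 := (SeqSub gamma_in_roots).

Lemma gal_roots_trans (y : seq_sub rs) : exists2 g, g \in G & to x0 g = y.
Proof.
have rt : root (minPoly 1 gamma) (val y) by rewrite -mem_gal_roots; exact: valP.
have [g Gg Dy] := normalField_root_minPoly (sub1v _) (normalFieldf _) (memvf _) rt.
by exists g => //; apply: val_inj.
Qed.

Local Notation f := (min_polyZ (QC gamma)).
Local Notation c := ((lead_coef f)%:~R : L).
Let P := c *: \prod_(B in Bs) ('X - (orbit_norm B)%:P).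

(** As [H] is normal, [g] permutes the [H]-orbits, and hence the factors of [P]. *)
Lemma orbit_polyL_fixed (g : gal_of {:L}) : map_poly g P = P.
Proof.
rewrite /P map_polyZ rmorph_int map_prod_XsubC; congr (_ *: _).
rewrite [RHS](@big_orbits_act _ _ to _ _ gal_normal _ _ _ g _ (gal_all g)).
by apply: eq_bigr => B _; congr ('X - _%:P); apply: gal_orbit_norm.
Qed.

Lemma min_polyZ_prod_roots : map_poly intr f = c *: \prod_(x <- rs) ('X - x%:P).
Proof. by rewrite map_poly_intr_minPoly Drs. Qed.

Lemma big_roots (S : Type) (idx : S) (op : Monoid.com_law idx) (F : L -> S) :
  \big[op/idx]_(x : seq_sub rs) F (val x) = \big[op/idx]_(x <- rs) F x.
Proof.
rewrite -(big_map val predT F) /index_enum -enumT.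
apply: perm_big; apply: uniq_perm => //.
  by rewrite map_inj_uniq ?enum_uniq //; apply: val_inj.
move=> x; apply/mapP/idP => [[y _ ->]|xrs]; first exact: valP.
by exists (SeqSub xrs); rewrite ?mem_enum.
Qed.

(** The orbits are disjoint, so a product of orbit norms is the product of the distinct roots in the
    union of these orbits; with the factor [c] it is integral by [integral_sub_prod]. *)
Lemma integral_orbit_polyL j : integralOver (intr : int -> L) P`_j.
Proof.
rewrite /P -big_enum; apply: integral_coef_prod_XsubC => m.
set bs := mask m _; pose S := [set B in bs].
have sSB : S \subset Bs.
  by apply/fintype.subsetP => B; rewrite inE => /mem_mask; rewrite mem_enum.
have tS : finset.trivIset S.
  have /and3P[_ tB _] : finset.partition Bs [set: seq_sub rs].
    by apply: orbit_partition; apply/actsP => h Hh x; rewrite !inE.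
  exact: finset.trivIsetS tB.
have -> : \prod_(B <- bs) orbit_norm B =
    \prod_(x <- map val (enum (finset.cover S))) x.
  rewrite big_map big_enum finset.big_trivIset //= big_uniq ?mask_uniq ?enum_uniq //=.
  by apply: eq_bigl => B; rewrite inE.
apply: integral_sub_prod (rs) _ _ => [|i].
  exists (map val (enum (~: finset.cover S))); rewrite -map_cat.
  apply: uniq_perm => //.
    rewrite map_inj_uniq; last exact: val_inj.
    rewrite cat_uniq !enum_uniq andbT; apply/hasPn => x /=.
    by rewrite !mem_enum inE.
  move=> x; apply/mapP/idP => [[y _ ->]|xrs]; first exact: valP.
  by exists (SeqSub xrs) => //; rewrite mem_cat !mem_enum inE orbN.
rewrite -min_polyZ_prod_roots coef_map; exact: mxpoly.integral_id.
Qed.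

(** Each coefficient is rational because the whole Galois group fixes it, and integral, so it is an
    integer. *)
Lemma orbit_poly_exists : exists p : {poly int}, map_poly intr p = P.
Proof.
have coefZ j : {n : int | P`_j = n%:~R}.
  apply: cid; apply: integral_fixed_int (integral_orbit_polyL j).
  have /galois_fixedField <- := galois_fullv.
  apply/fixedFieldP; first exact: memvf.
  by move=> g _; rewrite -[in RHS](orbit_polyL_fixed g) coef_map.
exists (\poly_(j < size P) sval (coefZ j)); apply/polyP => j.
rewrite coef_map coef_poly; case: ltnP => [_|le_j]; first by case: (coefZ j).
by rewrite nth_default.
Qed.

Lemma orbit_norm_in (x : seq_sub rs) : orbit_norm (orbH x) \in E.
Proof.
have galE : galois E {:L} by apply: galoisS galois_fullv; rewrite sub1v subvf.
suff: orbit_norm (orbH x) \in fixedField H by have /galois_fixedField -> := galE.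
apply/fixedFieldP => [|h Hh]; first exact: memvf.
rewrite gal_orbit_norm.
congr orbit_norm; rewrite -[RHS](orbit_act to x Hh).
exact: (setact_orbit_normal to gal_normal _ (gal_all h)).
Qed.

Lemma orbit_norm_galNorm :
  orbit_norm (orbH x0) ^+ #|('C_H[x0 | to])%g| = galNorm E {:L} gamma.
Proof. by rewrite -prod_act_orbit. Qed.

(** The index of [H] in [G] is the degree of [E], by Lagrange and the Galois correspondence. *)
Lemma card_gal_orbits : (#|Bs| <= \dim E)%N.
Proof.
apply: leq_trans (card_orbits_le gal_normal gal_roots_trans) _.
have galE : galois E {:L} by apply: galoisS galois_fullv; rewrite sub1v subvf.
have := Lagrange (normal_sub gal_normal).
rewrite /= -(galois_dim galois_fullv) -(galois_dim galE) dimv1 divn1.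
rewrite -[RHS](divnK (field_dimS (subvf E))) mulnC [RHS]mulnC => /eqP.
by rewrite eqn_pmul2r => [/eqP->|] //; rewrite (galois_dim galE) cardG_gt0.
Qed.

Section Mahler.
Variables (R : realType) (kappa : {rmorphism L -> R[i]}) (p : {poly int}).
Hypothesis Dp : map_poly intr p = P.
Local Notation nc := (@Normc.normc R).
Local Notation m p := (poly_mahler (map_poly (intr : int -> R[i]) p)).

Lemma lead_min_polyZ_neq0 : c != 0.
Proof.
rewrite -(rmorph0 (intr : int -> L)) (inj_eq intL_inj).
by rewrite lead_coef_eq0 min_polyZ_neq0.
Qed.

Lemma orbit_poly_neq0 : p != 0.
Proof.
apply/eqP => p0; move: Dp; rewrite p0 rmorph0 => /esym/eqP.
rewrite scaler_eq0 (negPf lead_min_polyZ_neq0) /=.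
by rewrite (negPf (monic_neq0 (monic_prod_XsubC _ _ _))).
Qed.

Lemma size_orbit_poly : (size p <= (\dim E).+1)%N.
Proof.
rewrite -(size_map_inj_poly intL_inj (rmorph0 _)) Dp.
rewrite size_scale ?lead_min_polyZ_neq0 //.
by rewrite -big_enum size_prod_XsubC -cardE ltnS card_gal_orbits.
Qed.

Lemma orbit_poly_root : root (map_poly intr p) (orbit_norm (orbH x0)).
Proof.
rewrite Dp rootZ ?lead_min_polyZ_neq0 //.
rewrite (bigD1 (orbH x0)) ?imset_f ?finset.in_setT //=.
by rewrite rootM root_XsubC eqxx.
Qed.

Lemma mahler_orbits : mahler R (QC gamma) =
  ln (nc (kappa c)) + \sum_(B in Bs) \sum_(x in B) logp (nc (kappa (val x))).
Proof.
rewrite /mahler -(big_orbits to).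
rewrite (@poly_mahler_split _ kappa _ c (seq_sub rs) predT val) //.
  exact: min_polyZ_neq0.
by rewrite min_polyZ_prod_roots -big_roots.
Qed.

Lemma mahler_orbit_poly : m p =
  ln (nc (kappa c)) + \sum_(B in Bs) logp (\prod_(x in B) nc (kappa (val x))).
Proof.
rewrite (poly_mahler_split kappa orbit_poly_neq0 Dp); congr (_ + _).
by apply: eq_bigr => B _; rewrite /orbit_norm rmorph_prod normc_prod.
Qed.

Lemma orbit_poly_mahler_le : m p <= mahler R (QC gamma).
Proof.
rewrite mahler_orbits mahler_orbit_poly lerD2l; apply: ler_sum => B _.
by apply: logp_prod_le => x; apply: normc_ge0.
Qed.

(** Subadditivity of [logp] is an equality on factors of equal modulus, and the elements of an
    [H]-orbit have equal modulus since they share their [r]-th power. *)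
Lemma orbit_poly_mahler_eq r : (0 < r)%N -> gamma ^+ r \in E ->
  m p = mahler R (QC gamma).
Proof.
move=> r0 Er; rewrite mahler_orbits mahler_orbit_poly; congr (_ + _).
apply: eq_bigr => _ /imsetP[y _ ->]; have [g Gg Dy] := gal_roots_trans y.
(* [E] is normal, so the automorphism [g] sending [gamma] to [y] maps [E] into itself. *)
have Ey : val y ^+ r \in E.
  have kE : kAut 1 E g.
    move: Gg; rewrite gal_kAut ?sub1v //.
    by apply: normalField_kAut nE; rewrite sub1v subvf.
  have <- : g (gamma ^+ r) = val y ^+ r by rewrite -Dy; apply: rmorphXn.
  by move: kE; rewrite kAutE => /andP[_ /subvP]; apply; apply: memv_img.
have nx (x : seq_sub rs) : x \in orbH y -> nc (kappa (val x)) = nc (kappa (val y)).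
  case/orbitP => h Hh <-; apply/eqP; rewrite -(@eqrXn2 _ r) ?normc_ge0 //.
  have hE : val (to y h) ^+ r = val y ^+ r.
    rewrite -[RHS](fixed_gal (subvf E) Hh Ey); exact/esym/rmorphXn.
  by rewrite -!normcX -!(rmorphXn kappa) hE.
rewrite (eq_bigr (fun=> nc (kappa (val y)))) // prodr_const logpX ?normc_ge0 //.
by rewrite -sumr_const; apply: eq_bigr => x /nx->.
Qed.
End Mahler.
End Orbits.

(** Here [N] is the product of the orbit of [gamma], [D] the size of this orbit and [k] the order of
    the stabilizer. The bound on [size p] depends on [E] alone, not on [gamma] or [L]. *)
Lemma orbit_poly (R : realType) (kappa : {rmorphism L -> R[i]}) gamma :
  exists p (N : L) (D k : nat),
  [/\ p != 0, (size p <= (\dim E).+1)%N, root (map_poly intr p) N & N \in E] /\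
  [/\ (D * k = #|H|)%N, N ^+ k = galNorm E {:L} gamma,
      poly_mahler (map_poly (intr : int -> R[i]) p) <= mahler R (QC gamma)
    & forall r, (0 < r)%N -> gamma ^+ r \in E ->
      poly_mahler (map_poly (intr : int -> R[i]) p) = mahler R (QC gamma)].
Proof.
have [rs uniq_rs Drs] := gal_roots gamma.
have [p Dp] := orbit_poly_exists uniq_rs Drs.
pose x0 : seq_sub rs := SeqSub (gamma_in_roots Drs).
pose to := gal_roots_action Drs.
exists p, (orbit_norm (orbit to H x0)), #|orbit to H x0|, #|('C_H[x0 | to])%g|.
split; split.
- exact: orbit_poly_neq0 Dp.
- exact: size_orbit_poly Dp.
- exact: orbit_poly_root Dp.
- exact: orbit_norm_in.
- by apply: card_orbit_in_stab; apply: finset.subsetT.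
- exact: orbit_norm_galNorm.
- exact: orbit_poly_mahler_le Dp.
- exact: orbit_poly_mahler_eq Dp.
Qed.
End OrbitPolynomial.

(** * Finiteness of the values on the radical closure *)

Local Open Scope classical_set_scope.

Lemma finite_set_finType (T : finType) (A : set T) : finite_set A.
Proof.
apply: (@sub_finite_set _ _ [set` enum T]); last exact: finite_seq.
by move=> x _ /=; rewrite mem_enum.
Qed.

Lemma finite_poly_int d N : finite_set
  [set p : {poly int} | (size p <= d)%N /\ forall j, (absz (p`_j)%R <= N)%N].
Proof.
(* Shifting by [N] puts coefficients of absolute value at most [N] in the range from 0 to
   [N + N]. *)
pose F (f : {ffun 'I_d -> 'I_(N + N).+1}) : {poly int} :=
  \poly_(i < d) (if insub i is Some i' then (f i')%:Z - N%:Z else 0).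
apply: sub_finite_set (finite_image F (finite_set_finType [set: _])).
move=> p [sz_p le_p]; exists [ffun i : 'I_d => inord (absz (p`_i + N%:Z))] => //.
apply/polyP => i; rewrite coef_poly; case: ltnP => [lt_id|le_di].
  rewrite insubT ffunE /= inordK.
    by move: (p`_i) (le_p i) => c; lia.
  by move: (p`_i) (le_p i) => c; lia.
by rewrite nth_default // (leq_trans sz_p).
Qed.

(** Northcott's argument: bounds on the degree and the measure bound the integer coefficients. *)
Lemma northcott_values (R : realType) d (B : R) :
  finite_set [set poly_mahler (map_poly (intr : int -> R[i]) p) | p in
    [set p : {poly int} | [/\ p != 0, (size p <= d.+1)%N &
      poly_mahler (map_poly (intr : int -> R[i]) p) <= B]]].
Proof.
pose C : R := expR B * (1 + expR B) ^+ d.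
apply: finite_image; apply: sub_finite_set (finite_poly_int d.+1 (Num.trunc C)).
move=> p [p0 sz_p le_mB]; split=> // j.
have le_C : Normc.normc (map_poly (intr : int -> R[i]) p)`_j <= C.
  apply: le_trans (normc_coef_le j p0 le_mB) _.
  rewrite ler_wpM2l ?expR_ge0 // ler_weXn2l ?lerDl ?expR_ge0 //.
  by rewrite -ltnS (leq_trans _ sz_p) // prednK // size_poly_gt0.
rewrite truncn_ge_nat; last by rewrite mulr_ge0 ?exprn_ge0 ?addr_ge0 ?expR_ge0.
by move: le_C; rewrite coef_map normc_int.
Qed.

(** A concrete model of the Galois closure: its generators are explicit, so it can be realized
    inside a number field and its degree bounded. *)
Definition conj_field (alpha : algC) : set algC :=
  smallest subfield [set z | root (map_poly intr (min_polyZ alpha)) z].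

Lemma sub_conj_field alpha z :
  root (map_poly intr (min_polyZ alpha)) z -> conj_field alpha z.
Proof. by move=> rz K [_]; apply. Qed.

Lemma conj_field_closure alpha : conj_field alpha `<=` galois_closure alpha.
Proof.
move=> z Kz K [[sK nK] sQK]; apply: Kz; split=> // {}z rz.
have [_ /irreducible_rat_int irr rt] := min_polyZP alpha.
rewrite /= map_poly_ratr_intr in rz.
apply: nK rz => //; exists alpha; first by apply: sQK => F [_]; apply.
by rewrite -map_poly_ratr_intr.
Qed.

Lemma subfield_conj_field alpha : subfield (conj_field alpha).
Proof.
split.
- by apply/mem_set => K [[K1 _ _] _]; apply: set_mem.
- move=> u v /set_mem Ku /set_mem Kv; apply/mem_set => K [sK rK].
  have [_ KB _] := sK.
  by apply: set_mem; apply: KB; apply/mem_set; [apply: Ku|apply: Kv].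
- move=> u v /set_mem Ku /set_mem Kv; apply/mem_set => K [sK rK].
  have [_ _ KV] := sK.
  by apply: set_mem; apply: KV; apply/mem_set; [apply: Ku|apply: Kv].
Qed.

Lemma subfieldP (K : set algC) : subfield K ->
  [/\ K 1, forall u v, K u -> K v -> K (u - v)
    & forall u v, K u -> K v -> K (u / v)].
Proof.
case=> K1 KB KV; split=> [|u v Ku Kv|u v Ku Kv]; apply: set_mem => //.
  by apply: KB; apply: mem_set.
by apply: KV; apply: mem_set.
Qed.

(** * Images of number fields in subfields of the algebraic numbers *)

Section SubfieldImage.
Variables (K : set algC) (sK : subfield K).

Lemma subfield0 : K 0.
Proof. by have [K1 KB _] := subfieldP sK; rewrite -(subrr 1); apply: KB. Qed.

Lemma subfieldD u v : K u -> K v -> K (u + v).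
Proof.
have [K1 KB _] := subfieldP sK; move=> Ku Kv.
rewrite -[v]opprK -[- v]sub0r; apply: (KB) => //; apply: (KB) => //.
exact: subfield0.
Qed.

Lemma subfieldM u v : K u -> K v -> K (u * v).
Proof.
have [K1 _ KV] := subfieldP sK; move=> Ku Kv.
by rewrite -[v]invrK -[v^-1]div1r; apply: (KV) => //; apply: (KV).
Qed.

Lemma subfield_rat r : K (ratr r).
Proof.
have [K1 KB KV] := subfieldP sK.
have Kn n : K n%:R.
  elim: n => [|n IHn]; first exact: subfield0.
  by rewrite -natr1; apply: subfieldD.
have Kz (n : int) : K n%:~R.
  case: n => n; first exact: Kn.
  rewrite NegzE rmorphN /= -sub0r; apply: KB; [exact: subfield0 | exact: Kn].
by rewrite /ratr; apply: KV.
Qed.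

Lemma subfield_adjoin (L : fieldExtType rat) (QC : {rmorphism L -> algC}) (s : seq L) :
  {in s, forall y, K (QC y)} -> forall y, y \in <<1 & s>>%VS -> K (QC y).
Proof.
have Kz y : y \in 1%VS -> K (QC y).
  by case/vlineP => r ->; rewrite alg_num_field fmorph_rat; apply: subfield_rat.
(* The base field has to vary, as the induction adjoins one element at a time. *)
suff: forall (U : {subfield L}), (forall y, y \in U -> K (QC y)) ->
    {in s, forall y, K (QC y)} -> forall y, y \in <<U & s>>%VS -> K (QC y).
  by move=> /(_ 1%AS); apply.
elim: s => [|x s IHs] U KU Ks y.
  by rewrite adjoin_nil subfield_closed; apply: KU.
rewrite adjoin_cons; apply: IHs => [{}y|z zs]; last first.
  by apply: Ks; rewrite inE zs orbT.
case/Fadjoin_polyP => p Up ->; rewrite -horner_map horner_coef.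
elim/big_ind: _ => [||i _]; [exact: subfield0|exact: subfieldD|].
apply: subfieldM; first by rewrite coef_map; apply/KU/polyOverP.
elim: (nat_of_ord i) => [|n IHn]; first by case: (subfieldP sK).
by rewrite exprS; apply: subfieldM => //; apply: Ks; rewrite mem_head.
Qed.
End SubfieldImage.

(** * Radicals over the field of conjugates *)

Section ConjugateField.
Variable alpha : algC.
Local Notation f := (min_polyZ alpha).
Local Notation n := (size f).-1.

Lemma dim_adjoin_seq_le (L : fieldExtType rat) (p : {poly int}) (s : seq L)
    (U : {subfield L}) :
  map_poly intr p != 0 :> {poly L} -> {in s, forall y, root (map_poly intr p) y} ->
  (\dim <<U & s>> <= (size (map_poly intr p : {poly L})).-1 ^ size s * \dim U)%N.
Proof.
move=> p0; elim: s U => [|x s IHs] U rs.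
  by rewrite adjoin_nil subfield_closed mul1n.
rewrite adjoin_cons; apply: leq_trans (IHs <<U; x>>%AS _) _ => [y ys|].
  by apply: rs; rewrite inE ys orbT.
rewrite dim_Fadjoin mulnA leq_mul2r /= expnSr leq_mul2l; apply/orP; right.
apply/orP; right.
have dv : minPoly U x %| map_poly intr p.
  by apply: minPoly_dvdp; rewrite ?rs ?mem_head // map_poly_intr_in_alg alg_polyOver.
have := dvdp_leq p0 dv; rewrite size_minPoly.
by case: (size _).
Qed.

(** [L] is made large enough for [s], while [E] is generated by the [n] conjugates of [alpha] alone;
    hence its degree is bounded independently of [s]. *)
Lemma num_field_setup (s : seq algC) :
  exists (L : splittingFieldType rat) (QC : {rmorphism L -> algC})
    (E : {subfield L}) (s1 : seq L),
  [/\ map QC s1 = s, normalField 1 E, (\dim E <= n ^ n)%N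
    & forall y, y \in E <-> conj_field alpha (QC y)].
Proof.
have [rs Drs] := closed_field_poly_normal (map_poly intr f : {poly algC}).
have inj : injective (intr : int -> algC) by exact: intr_inj.
have lc : lead_coef (map_poly intr f : {poly algC}) != 0.
  by rewrite lead_coef_map_inj // intr_eq0 lead_coef_eq0 min_polyZ_neq0.
have sz_rs : size rs = n.
  by rewrite -(size_map_inj_poly inj (rmorph0 _)) Drs size_scale // size_prod_XsubC.
have [L [QC [s1 Ds1]]] := splitting_num_field_exists (rs ++ s).
pose cs := take (size rs) s1.
have Dcs : map QC cs = rs by rewrite map_take Ds1 take_size_cat.
pose E := <<1 & cs>>%AS; exists L, QC, E, (drop (size rs) s1).
have fL0 : map_poly intr f != 0 :> {poly L}.
  rewrite -(map_poly_eq0 QC) map_poly_intr_morph.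
  by rewrite -lead_coef_eq0.
have rt_cs y : (y \in cs) = root (map_poly intr f) y.
  rewrite -(mem_map (fmorph_inj QC)) Dcs -root_prod_XsubC -(rootZ _ _ lc) -Drs.
  by rewrite -(map_poly_intr_morph QC) fmorph_root.
split.
- by rewrite map_drop Ds1 drop_size_cat.
- apply/splitting_normalField; first exact: sub1v.
  exists (map_poly intr f); first by rewrite map_poly_intr_in_alg alg_polyOver.
  exists cs => //; rewrite -(eqp_map QC) map_poly_intr_morph Drs map_prod_XsubC.
  by rewrite -(big_map QC predT (fun z => 'X - z%:P)) Dcs eqp_scale.
- have := @dim_adjoin_seq_le L f cs 1%AS fL0.
  rewrite dimv1 muln1 -(size_map QC cs) Dcs sz_rs (size_map_inj_poly (intL_inj QC)) //.
  by apply => y; rewrite rt_cs.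
move=> y; split=> [Ey|Ky].
  apply: (subfield_adjoin (subfield_conj_field alpha)) => [z|]; last exact: Ey.
  rewrite rt_cs => rz; apply: sub_conj_field.
  by rewrite -(map_poly_intr_morph QC) fmorph_root.
(* The image of [E] is a subfield containing the conjugates of [alpha], so it contains the smallest
   one. *)
suff [y1 Ey1 /fmorph_inj <-] : [set z | exists2 y1, y1 \in E & QC y1 = z] (QC y).
  by [].
apply: Ky; split=> [|z /= rz].
  split.
  - by apply: mem_set; exists 1; rewrite ?mem1v ?rmorph1.
  - move=> _ _ /set_mem[u Eu <-] /set_mem[v Ev <-]; apply: mem_set.
    by exists (u - v); rewrite ?rpredB ?rmorphB.
  move=> _ _ /set_mem[u Eu <-] /set_mem[v Ev <-]; apply: mem_set.
  by exists (u / v); rewrite ?rpred_div ?fmorph_div.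
have : z \in rs by rewrite -root_prod_XsubC -(rootZ _ _ lc) -Drs.
rewrite -Dcs => /mapP[y1 y1cs ->]; exists y1 => //.
exact: seqv_sub_adjoin.
Qed.

Variable R : realType.
Local Notation m p := (poly_mahler (map_poly (intr : int -> R[i]) p)).
Local Notation RadK := (Rad (conj_field alpha)).

(** The degree of [beta] is unbounded on [RadK], but its measure is also that of an orbit
    polynomial, of bounded degree. *)
Lemma mahler_Rad_poly beta : RadK beta ->
  exists p : {poly int}, [/\ p != 0, (size p <= (n ^ n).+1)%N & m p = mahler R beta].
Proof.
case=> _ [r r_gt0 Kbr].
have [L [QC [E [s1 [Ds1 nE dimE KE]]]]] := num_field_setup [:: beta].
case: s1 Ds1 => [//|y [//|//]] [Dy].
have [kappa] := @num_field_embedding L (R[i]).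
have [p [N [D [k [[p0 sz_p _ _] [_ _ _ eq_m]]]]]] := orbit_poly QC nE kappa y.
exists p; split=> //; first by apply: leq_trans sz_p _; rewrite ltnS.
by rewrite -Dy; apply: eq_m r_gt0 _; apply/KE; rewrite rmorphXn /= Dy.
Qed.

Lemma finite_mahler_Rad (B : R) :
  finite_set [set mahler R beta |
    beta in [set beta | RadK beta /\ mahler R beta <= B]].
Proof.
apply: sub_finite_set (northcott_values (n ^ n) B) => _ [beta [Rb le_B] <-].
have [p [p0 sz_p Dp]] := mahler_Rad_poly Rb.
by exists p => //; split=> //; rewrite Dp.
Qed.

Lemma mahler_root_Rad (s : nat -> algC) k : (forall i, s i != 0) ->
    \prod_(i < k) s i = alpha ->
  exists (t : nat -> algC) (zeta : algC),
  [/\ forall i : 'I_k, RadK (t i),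
      forall i : 'I_k, mahler R (t i) <= mahler R (s i),
      zeta * \prod_(i < k) t i = alpha
    & exists2 h, (0 < h)%N & zeta ^+ h = 1].
Proof.
move=> s0 Da.
have [L [QC [E [s1 [Ds1 nE dimE KE]]]]] := num_field_setup [seq s i | i <- iota 0 k].
have [kappa] := @num_field_embedding L (R[i]).
pose y i := s1`_i.
have sz_s1 : size s1 = k by rewrite -(size_map QC) Ds1 size_map size_iota.
have Dy (i : 'I_k) : QC (y i) = s i.
  by rewrite -(nth_map _ 0) ?sz_s1 // Ds1 (nth_map 0%N) ?size_iota // nth_iota.
(* [D] and [e] stand for the orbit size and the stabilizer order of [y i], and [N] for the product
   of the orbit. *)
pose Q i (t : algC) := exists (D e : nat) (N : L),
  [/\ N \in E, N != 0, (D * e)%N = #|'Gal({:L} / E)%g|, t ^+ D = QC N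
   & N ^+ e = galNorm E {:L} (y i)] /\ mahler R t <= mahler R (s i).
have Qt (i : 'I_k) : {t | Q i t}.
  apply: cid.
  have [p [N [D [e [[p0 _ rt EN] [De Ne le_m _]]]]]] := orbit_poly QC nE kappa (y i).
  have : (0 < D * e)%N by rewrite De cardG_gt0.
  rewrite muln_gt0 => /andP[D_gt0 e_gt0].
  have N0 : N != 0.
    apply: contra_neq (s0 i) => N0; move/eqP: Ne.
    rewrite N0 expr0n gtn_eqF // eq_sym galNorm_eq0 -Dy.
    by move/eqP->; rewrite rmorph0.
  (* Any [D]-th root would do: it is a root of [p \Po 'X^D], whose measure is that of [p]. *)
  exists (D.-root (QC N)), D, e, N; split; first by split; rewrite ?rootCK.
  rewrite -Dy; apply: le_trans le_m; rewrite -(int_mahler_comp_Xn _ p0 D_gt0).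
  apply: mahler_le; first by rewrite comp_poly_eq0 ?size_polyXn ?ltnS.
  rewrite map_comp_poly map_polyXn /root horner_comp hornerXn rootCK //.
  by rewrite -(map_poly_intr_morph QC) -/(root _ _) fmorph_root.
pose t i := if insub i is Some i' then sval (Qt i') else 1.
have Pt (i : 'I_k) : Q i (t i) by rewrite /t valK; case: (Qt i).
exists t, (alpha / \prod_(i < k) t i).
have t0 (i : 'I_k) : t i != 0.
  have [D [e [N [[EN N0 De tD _] _]]]] := Pt i.
  apply: contra_neq N0 => ti0; apply: (fmorph_inj QC).
  rewrite -tD ti0 rmorph0 expr0n; case: D De {tD} => // De.
  by have := cardG_gt0 'Gal({:L} / E)%G; rewrite -[#|_|]De.
split.
- move=> i; split; first exact: t0.
  have [D [e [N [[EN N0 De tD _] _]]]] := Pt i.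
  exists D; last by rewrite tD; apply/KE.
  by case: D De {tD} => // De; have := cardG_gt0 'Gal({:L} / E)%G; rewrite -[#|_|]De.
- by move=> i; have [D [e [N [_ ]]]] := Pt i.
- by rewrite divfK //; apply/prodf_neq0 => i _.
(* With [h] the order of the group, [alpha ^+ h] is the norm of [a], since [a] is in [E]. It is also
   the product of the norms of the [y i], each equal in [algC] to [t i ^+ h] because [h = D * e]. *)
exists #|'Gal({:L} / E)%g|; first exact: cardG_gt0.
pose a := \prod_(i < k) y i.
have QCa : QC a = alpha by rewrite rmorph_prod -Da; apply: eq_bigr => i _; apply: Dy.
have Ea : a \in E.
  by apply/KE; rewrite QCa; apply: sub_conj_field; have [] := min_polyZP alpha.
rewrite expr_div_n -prodrXl -QCa -rmorphXn.
have -> : a ^+ #|'Gal({:L} / E)%g| = galNorm E {:L} a.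
  rewrite /galNorm (eq_bigr (fun=> a)) ?prodr_const // => h Hh.
  exact: fixed_gal (subvf E) Hh Ea.
rewrite galNorm_prod rmorph_prod /=.
rewrite (eq_bigr (fun i : 'I_k => t i ^+ #|'Gal({:L} / E)%g|)).
  by rewrite divff // prodf_seq_neq0; apply/allP => i _; rewrite /= expf_neq0.
move=> i _; have [D [e [N [[EN N0 De tD <-] _]]]] := Pt i.
by rewrite -De exprM tD rmorphXn.
Qed.

End ConjugateField.

(** * The infimum is attained *)

Section LocallyFinite.
Variable R : realType.
Implicit Types (V S : set R) (B : R).

Definition locally_finite_below V := forall B, finite_set [set v | V v /\ v <= B].

Lemma finite_set_min S : finite_set S -> S !=set0 ->
  exists2 m, S m & forall s, S s -> m <= s.
Proof.
case/finite_seqP => s -> [x /= xs]; elim: s x xs => // y s IHs x _.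
case: s IHs => [_|z s /(_ z (mem_head _ _))[m ms le_m]].
  by exists y => [|t] /=; rewrite ?inE // => /eqP->.
have [le_ym|lt_my] := leP y m.
  exists y => [|t] /=; first exact: mem_head.
  by rewrite in_cons => /predU1P[->//|/le_m]; apply: le_trans.
exists m => [|t] /=; first by rewrite in_cons ms orbT.
by rewrite in_cons => /predU1P[->|/le_m//]; apply: ltW.
Qed.

Lemma locally_finite_min S : locally_finite_below S -> S !=set0 ->
  exists2 m, S m & forall s, S s -> m <= s.
Proof.
move=> finS [s0 Ss0].
have [|m [Sm le_m] min_m] := finite_set_min (finS s0); first by exists s0.
exists m => // s Ss; have [/(conj Ss)/min_m//|lt_s0s] := leP s s0.
exact: le_trans le_m (ltW lt_s0s).
Qed.

Definition sums V : set R := [set s | exists2 l : seq R,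
  (forall v, v \in l -> V v) & s = \sum_(v <- l) v].

(* If the positive elements of [V] are at least [c], then a sum bounded by [B]
   has at most [B / c] nonzero terms. *)
Lemma locally_finite_sums V : (forall v, V v -> 0 <= v) ->
  locally_finite_below V -> locally_finite_below (sums V).
Proof.
move=> V0 finV B.
have [c c0 le_c] : exists2 c, 0 < c & forall v, V v -> v <= B -> v != 0 -> c <= v.
  pose Vp := [set v | (V v /\ v <= B) /\ v != 0].
  have finVp : finite_set Vp by apply: sub_finite_set (finV B) => v [].
  have [Vp0|/set0P Vp0] := eqVneq Vp set0.
    exists 1 => // v Vv le_v v0; have : Vp v by [].
    by rewrite Vp0.
  have [c [[Vc _] c0] min_c] := finite_set_min finVp Vp0.
  exists c; first by rewrite lt_def c0 V0.
  by move=> v Vv le_v v0'; apply: min_c.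
(* [W j] collects the sums of at most [j] elements of [V] below [B]; the added 0 pads shorter
   sums. *)
pose W := fix W j : set R := if j is i.+1 then
  [set v + w | v in [set v | V v /\ v <= B] `|` [set 0] & w in W i] else [set 0].
have finW j : finite_set (W j).
  elim: j => [|j IHj] /=; first exact: finite_set1.
  by apply: finite_image2 => //; rewrite finite_setU; split=> //; apply: finite_set1.
have W0 j : W j 0.
  by elim: j => //= j IHj; exists 0; [right|exists 0; rewrite ?addr0].
apply: sub_finite_set (finW (Num.trunc (B / c))) => _ [[l Vl ->] le_B].
have lt_B : \sum_(v <- l) v < (Num.trunc (B / c)).+1%:R * c.
  apply: le_lt_trans le_B _; rewrite -ltr_pdivrMr //.
  have [B0|B0] := leP 0 (B / c); first by case/andP: (truncn_itv B0).
  by apply: lt_le_trans B0 _.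
have l_ge0 l' : {subset l' <= l} -> 0 <= \sum_(v <- l') v.
  by move=> sl; rewrite big_seq; apply: sumr_ge0 => v /sl/Vl/V0.
have {Vl} Vl v : v \in l -> V v /\ v <= B.
  move=> vl; split; first exact: Vl.
  apply: le_trans le_B; rewrite (big_rem v vl) /= lerDl l_ge0 //.
  exact: mem_rem.
(* The number of allowed terms is generalized: a zero term leaves it unchanged, and a non-zero one
   lowers it by one and the sum by at least [c]. *)
elim: l (Num.trunc _) {le_B} lt_B l_ge0 Vl => [|v l IHl] j lt_j l_ge0 Vl.
  by rewrite big_nil.
have sl : {subset l <= v :: l} by move=> u ul; rewrite inE ul orbT.
have l0 : forall l', {subset l' <= l} -> 0 <= \sum_(v <- l') v.
  by move=> l' sl'; apply: l_ge0 => u /sl'/sl.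
have Vl' u : u \in l -> V u /\ u <= B by move/sl/Vl.
have [Vv vB] := Vl v (mem_head _ _).
move: lt_j; rewrite big_cons; have [->|v0] := eqVneq v 0.
  by rewrite add0r => lt_j; apply: IHl.
have le_cv := le_c v Vv vB v0; case: j => [|j] lt_j.
  by have := l0 l (fun _ => id); move: lt_j; rewrite mul1r; lra.
exists v; first by left.
exists (\sum_(u <- l) u) => //; apply: IHl => //.
by move: lt_j; rewrite -[j.+2%:R]natr1 mulrDl mul1r; lra.
Qed.
End LocallyFinite.

(** * Finitely supported sequences *)

Section Sequences.
Implicit Types a b : nat -> algC.

Lemma finite_support_bound a : finite_set [set n | a n != 1] ->
  exists k, forall n, (k <= n)%N -> a n = 1.
Proof.
case/finite_seqP => s Ds; exists (\max_(i <- s) i).+1 => n lt_n.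
apply/eqP/negPn/negP => an1; have ns : n \in s.
  by have : [set` s] n by rewrite -Ds.
by have := @leq_bigmax_seq _ s xpredT id n ns isT; rewrite leqNgt lt_n.
Qed.

Lemma finite_support_lt a k : (forall n, (k <= n)%N -> a n = 1) ->
  finite_set [set n | a n != 1].
Proof.
move=> ak; apply: (@sub_finite_set _ _ `I_k) => [n /= an1|]; last exact: finite_II.
by rewrite ltnNge; apply: contra an1 => /ak->.
Qed.

Lemma fsbig_nat_lt (S : Type) (idx : S) (op : Monoid.com_law idx) (F : nat -> S) k :
  (forall n, (k <= n)%N -> F n = idx) ->
  \big[op/idx]_(n \in [set: nat]) F n = \big[op/idx]_(n < k) F n.
Proof.
move=> Fk; rewrite fsbig_ord; apply/esym/fsbig_widen => // n [_ /= /negP].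
by rewrite -leqNgt => /Fk.
Qed.

Variable R : realType.

Lemma seq_mahler_finE (r : R) a k : 0 < r -> (forall n, (k <= n)%N -> a n = 1) ->
  seq_mahler r%:E a = (\sum_(n < k) mahler R (a n) `^ r) `^ r^-1.
Proof.
move=> r0 ak; rewrite /seq_mahler (@fsbig_nat_lt _ _ _ _ k) // => n /ak->.
by rewrite mahler1 powR0 // gt_eqF.
Qed.

Lemma seq_mahler_le (x : \bar R) a b : (0 < x)%E ->
    X_ Qbar_units a -> X_ Qbar_units b ->
    (forall n, mahler R (a n) <= mahler R (b n)) ->
  seq_mahler x a <= seq_mahler x b.
Proof.
move=> x0 Xa Xb le_ab; case: x x0 => [r|_|//].
  rewrite lte_fin => r0.
  have [ka ak] := finite_support_bound Xa.2.
  have [kb bk] := finite_support_bound Xb.2.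
  pose k := maxn ka kb.
  have Ea : seq_mahler r%:E a = (\sum_(n < k) mahler R (a n) `^ r) `^ r^-1.
    by apply: seq_mahler_finE => // n le_n; apply/ak/(leq_trans _ le_n)/leq_maxl.
  have Eb : seq_mahler r%:E b = (\sum_(n < k) mahler R (b n) `^ r) `^ r^-1.
    by apply: seq_mahler_finE => // n le_n; apply/bk/(leq_trans _ le_n)/leq_maxr.
  rewrite Ea Eb {Ea Eb}.
  have sum_ge0 c : 0 <= \sum_(n < k) mahler R (c n) `^ r.
    by apply: sumr_ge0 => n _; apply: powR_ge0.
  apply: ge0_ler_powR; rewrite ?nnegrE ?invr_ge0 ?sum_ge0 ?(ltW r0) //.
  apply: ler_sum => n _; apply: ge0_ler_powR; rewrite ?nnegrE ?mahler_ge0 //.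
  exact: ltW.
have [n -> _] := seq_mahlerT_max R Xa; have [n' -> le_n'] := seq_mahlerT_max R Xb.
exact: le_trans (le_ab n) (le_n' n).
Qed.
End Sequences.

(** * Reduction to radicals and existence of a minimum *)

Section MetricMahler.
Variables (R : realType) (alpha : algC) (x : \bar R).
Hypotheses (alpha_neq0 : alpha != 0) (x_gt0 : (0 < x)%E).
Local Notation K := (conj_field alpha).
Let good := tau_fiber alpha `&` X_ (Rad K).

Lemma good_of_fiber a : tau_fiber alpha a ->
  exists2 b, good b & seq_mahler x b <= seq_mahler x a.
Proof.
move=> [Xa /= Da]; have [k ak] := finite_support_bound Xa.2.
rewrite /tau (fsbig_nat_lt _ ak) in Da.
have [t [zeta [Rt le_t Dt [h h0 zh]]]] := mahler_root_Rad R Xa.1 Da.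
(* The root of unity goes to the index [k], just past the support bound of [a]. As its measure is 0,
   it does not spoil the termwise comparison. *)
pose b n := if (n < k)%N then t n else if n == k then zeta else 1.
have bk n : (k.+1 <= n)%N -> b n = 1.
  by move=> lt_n; rewrite /b ltnNge (ltnW lt_n) gtn_eqF.
have K1 : K 1 by have [] := subfieldP (subfield_conj_field alpha).
have zeta0 : zeta != 0.
  apply: contraTneq (oner_neq0 algC) => z0.
  by rewrite -zh z0 expr0n gtn_eqF // eqxx.
have Rb n : Rad K (b n).
  rewrite /b; case: ifP => [lt_n|_]; first exact: (Rt (Ordinal lt_n)).
  case: ifP => _; last by split; [apply: oner_neq0|exists 1%N; rewrite ?expr1n].
  by split=> //; exists h; rewrite ?zh.
have Xb : X_ Qbar_units b.
  by split; [move=> n; have [] := Rb n | apply: finite_support_lt bk].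
exists b.
  split; [split=> //= | by split=> //; have [] := Xb].
  rewrite /tau (fsbig_nat_lt _ bk) big_ord_recr /= /b ltnn eqxx mulrC -[RHS]Dt.
  by congr (_ * _); apply: eq_bigr => i _; rewrite ltn_ord.
apply: seq_mahler_le => // n; rewrite /b.
case: ifP => [lt_n|_]; first exact: (le_t (Ordinal lt_n)).
case: ifP => _; last by rewrite mahler1 mahler_ge0.
by rewrite (mahler_unity_root R h0 zh) mahler_ge0.
Qed.

(** For [x = +oo] a value is the measure of one entry. For finite [r] it is the [r^-1]-th power of a
    sum of elements of [V], so finiteness passes from single measures to sums. *)
Lemma locally_finite_good : locally_finite_below [set seq_mahler x a | a in good].
Proof.
move=> B; case: x x_gt0 => [r|_|//]; last first.
  apply: sub_finite_set (finite_mahler_Rad alpha B) => _ [[a [[Xa _] [Ra _]] <-]].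
  have [n -> _] := seq_mahlerT_max R Xa => le_B.
  by exists (a n).
rewrite lte_fin => r0.
pose V : set R := [set mahler R beta `^ r | beta in Rad K].
have V0 v : V v -> 0 <= v by case=> beta _ <-; apply: powR_ge0.
(* Applied with [y = r] to single entries, and with [y = r^-1] to the whole sum. *)
have le_powRV (s y C : R) : 0 <= s -> 0 < y -> s `^ y <= C -> s <= C `^ y^-1.
  move=> s0 y0 le_C; rewrite -[s]powRr1 // -(divff (lt0r_neq0 y0)) powRrM.
  apply: ge0_ler_powR; rewrite ?nnegrE ?invr_ge0 ?powR_ge0 ?(ltW y0) //.
  exact: le_trans (powR_ge0 _ _) le_C.
have finV : locally_finite_below V.
  move=> C; apply: sub_finite_set
      (finite_image (fun s => s `^ r) (finite_mahler_Rad alpha (C `^ r^-1))).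
  move=> _ [[beta Kb <-] le_C]; exists (mahler R beta) => //; exists beta => //.
  by split=> //; apply: le_powRV; rewrite ?mahler_ge0.
apply: sub_finite_set (finite_image (fun s => s `^ r^-1)
  (locally_finite_sums V0 finV (B `^ r))) => _ [[a [Fa [Ra fa]] <-]].
have [k ak] := finite_support_bound fa.
rewrite (seq_mahler_finE r0 ak) => le_B.
exists (\sum_(n < k) mahler R (a n) `^ r) => //; split.
  exists [seq mahler R (a n) `^ r | n <- iota 0 k].
    by move=> _ /mapP[n _ ->]; exists (a n).
  by rewrite big_map -[X in iota 0 X]subn0 -/(index_iota 0 k) big_mkord.
rewrite -[X in B `^ X]invrK; apply: le_powRV; rewrite ?invr_gt0 //.
by apply: sumr_ge0 => n _; apply: powR_ge0.
Qed.

Lemma metric_mahler_attained :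
  exists2 a, good a & metric_mahler x alpha = seq_mahler x a.
Proof.
(* The sequence starting with [alpha] and continuing with 1 shows that the fiber, and then [good],
   is non-empty. *)
pose a0 n := if n == 0%N then alpha else 1.
have a0k n : (1 <= n)%N -> a0 n = 1 by rewrite /a0; case: n.
have Fa0 : tau_fiber alpha a0.
  split; first split.
  - by move=> n; rewrite /a0 /Qbar_units /=; case: ifP => // _; apply: oner_neq0.
  - exact: finite_support_lt a0k.
  by rewrite /= /tau (fsbig_nat_lt _ a0k) big_ord1.
have [b0 gb0 _] := good_of_fiber Fa0.
have [|_ [b gb <-] min_b] := locally_finite_min locally_finite_good.
  by exists (seq_mahler x b0), b0.
(* Every sequence of the fiber is dominated by a good one, so the minimum over [good] bounds the
   whole fiber from below. *)
have lb : lbound [set seq_mahler x a | a in tau_fiber alpha] (seq_mahler x b).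
  move=> _ [a Fa <-]; have [b1 gb1 le_b1] := good_of_fiber Fa.
  by apply: le_trans le_b1; apply: min_b; exists b1.
exists b => //; apply/eqP; rewrite eq_le; apply/andP; split.
  apply: ge_inf; last by exists b => //; case: gb.
  by exists (seq_mahler x b).
by apply: lb_le_inf => //; exists (seq_mahler x a0), a0.
Qed.

End MetricMahler.

Theorem theorem1p1 (R : realType) (alpha : algC) (x : \bar R)
    (alpha_neq0 : alpha != 0) (x_gt0 : (0 < x)%E) :
  exists2 a : nat -> algC,
    (tau_fiber alpha `&` X_ (Rad (galois_closure alpha))) a
    & metric_mahler x alpha = seq_mahler x a.
Proof.
have [a [Fa [Ra fa]] ->] := metric_mahler_attained alpha_neq0 x_gt0.
exists a => //; split=> //; split=> // n; have [a0 [r r0 Kr]] := Ra n.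
by split=> //; exists r => //; apply: conj_field_closure.
Qed.
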